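(* The subgroup $\mathrm{Aut}_{\mathcal{D}_2}(\mathcal{Q}_2)$ is maximal abelian in $\mathrm{Aut}(\mathcal{Q}_2)$.
   Context: $\mathcal{Q}_2$ (the 2-adic ring $C^*$-algebra) is the universal unital $C^*$-algebra generated by an isometry $S_2$ and a unitary $U$ such that $S_2S_2^*+US_2S_2^*U^*=1$ and $S_2U=U^2S_2$. Put $S_1=US_2$. For a multi-index $\alpha=(\alpha_1,\ldots,\alpha_k)\in\{1,2\}^k$ let $S_\alpha=S_{\alpha_1}\cdots S_{\alpha_k}$ and $P_\alpha=S_\alpha S_\alpha^*$; the diagonal subalgebra $\mathcal{D}_2\subset\mathcal{Q}_2$ is the (commutative) $C^*$-algebra generated by all projections $P_\alpha$. $\mathrm{Aut}(\mathcal{Q}_2)$ is the group of unital $*$-automorphisms of $\mathcal{Q}_2$ and $\mathrm{Aut}_{\mathcal{D}_2}(\mathcal{Q}_2)$ is the subgroup of those fixing every element of $\mathcal{D}_2$. A subgroup is maximal abelian if it is abelian and is not properly contained in any abelian subgroup. *)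

(* Defs.v *)
From HB Require Import structures.
From mathcomp Require Import all_boot all_order all_algebra all_fingroup.
From mathcomp Require Import all_classical all_reals all_analysis.
From mathcomp Require Import complex.

Set Implicit Arguments.
Unset Strict Implicit.
Unset Printing Implicit Defensive.

Import Order.TTheory GRing.Theory Num.Theory.
Import numFieldNormedType.Exports.

Local Open Scope classical_set_scope.
Local Open Scope ring_scope.

(** Unital C*-algebras over [R[i]], with norms valued in [R[i]] as for every
    [normedModType R[i]].  The product is a field of the record because
    Hierarchy-Builder cannot join [algType] and [normedModType] ([numDomainType]
    is already declared above both); [cstar_sort A] then receives both
    structures as instances, so the usual ring and norm notations apply to it.
    The axiom [1 != 0], needed for [algType], excludes the zero algebra. *)
Record cstarType (R : realType) := CStarType {
  cstar_car : completeNormedModType R[i];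
  cstar_mul : cstar_car -> cstar_car -> cstar_car;
  cstar_one : cstar_car;
  cstar_star : cstar_car -> cstar_car;
  cstar_mulA : associative cstar_mul;
  cstar_mul1 : left_id cstar_one cstar_mul;
  cstar_mulr1 : right_id cstar_one cstar_mul;
  cstar_mulDl : left_distributive cstar_mul +%R;
  cstar_mulDr : right_distributive cstar_mul +%R;
  cstar_one_neq0 : cstar_one != 0;
  cstar_scaleAl : forall (a : R[i]) x y,
    a *: cstar_mul x y = cstar_mul (a *: x) y;
  cstar_scaleAr : forall (a : R[i]) x y,
    a *: cstar_mul x y = cstar_mul x (a *: y);
  cstar_starK : involutive cstar_star;
  cstar_starD : {morph cstar_star : x y / x + y};
  cstar_starZ : forall (a : R[i]) x, cstar_star (a *: x) = a^* *: cstar_star x;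
  cstar_starM : forall x y,
    cstar_star (cstar_mul x y) = cstar_mul (cstar_star y) (cstar_star x);
  cstar_normM : forall x y, `|cstar_mul x y| <= `|x| * `|y|;
  cstar_normS : forall x, `|cstar_mul (cstar_star x) x| = `|x| ^+ 2
}.

Definition cstar_sort (R : realType) (A : cstarType R) : Type := cstar_car A.
Coercion cstar_sort : cstarType >-> Sortclass.

Section cstar_instances.
Variables (R : realType) (A : cstarType R).

HB.instance Definition _ :=
  CompleteNormedModule.copy (cstar_sort A) (cstar_car A).

HB.instance Definition _ := GRing.Zmodule_isNzRing.Build (cstar_sort A)
  (@cstar_mulA R A) (@cstar_mul1 R A) (@cstar_mulr1 R A)
  (@cstar_mulDl R A) (@cstar_mulDr R A) (@cstar_one_neq0 R A).

HB.instance Definition _ := GRing.Lmodule_isLalgebra.Build R[i] (cstar_sort A)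
  (@cstar_scaleAl R A).

HB.instance Definition _ := GRing.Lalgebra_isAlgebra.Build R[i] (cstar_sort A)
  (@cstar_scaleAr R A).

Definition star (x : A) : A := cstar_star x.

Lemma starK : involutive star. Proof. exact: cstar_starK. Qed.

Lemma starD : {morph star : x y / x + y}. Proof. exact: cstar_starD. Qed.

Lemma starZ (a : R[i]) (x : A) : star (a *: x) = a^* *: star x.
Proof. exact: cstar_starZ. Qed.

Lemma starM (x y : A) : star (x * y) = star y * star x.
Proof. exact: cstar_starM. Qed.

Lemma cstar_normrM (x y : A) : `|x * y| <= `|x| * `|y|.
Proof. exact: cstar_normM. Qed.

Lemma cstar_identity (x : A) : `|star x * x| = `|x| ^+ 2.
Proof. exact: cstar_normS. Qed.

End cstar_instances.

Definition unital_star_hom (R : realType) (A B : cstarType R) (f : A -> B) :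
    Prop :=
  [/\ linear f, monoid_morphism f & {morph f : x / star x}].

Definition cstar_subalgebra (R : realType) (A : cstarType R) (B : set A) :
    Prop :=
  [/\ B 0,
      forall (a : R[i]) (x y : A), B x -> B y -> B (a *: x + y),
      forall x y : A, B x -> B y -> B (x * y),
      forall x : A, B x -> B (star x)
    & closed B].

Definition cstar_generated (R : realType) (A : cstarType R) (X : set A) :
    set A :=
  \bigcap_(B in [set B | cstar_subalgebra B /\ X `<=` B]) B.

Section automorphism_group.
Variables (R : realType) (A : cstarType R).

Record star_aut := StarAut {
  star_aut_fun :> A -> A;
  star_aut_hom : unital_star_hom star_aut_fun;
  star_aut_bij : bijective star_aut_fun
}.

Lemma star_autP (f g : star_aut) : f =1 g -> f = g.
Proof.
case: f g => [f fh fb] [g gh gb] /= /funext fg.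
by case: _ / fg in gh gb *; congr StarAut; exact: Prop_irrelevance.
Qed.

HB.instance Definition _ := gen_eqMixin star_aut.
HB.instance Definition _ := gen_choiceMixin star_aut.

Lemma unital_star_hom_id : unital_star_hom (idfun : A -> A).
Proof. by []. Qed.

Lemma unital_star_hom_comp (f g : A -> A) :
  unital_star_hom f -> unital_star_hom g -> unital_star_hom (f \o g).
Proof.
move=> [fl [f1 fM] fs] [gl [g1 gM] gs]; split=> [a x y||x] /=.
- by rewrite gl fl.
- by split=> [|x y] /=; rewrite ?g1 ?gM ?f1 ?fM.
- by rewrite gs fs.
Qed.

Lemma unital_star_hom_can (f g : A -> A) :
  cancel f g -> cancel g f -> unital_star_hom f -> unital_star_hom g.
Proof.
move=> fK gK [fl [f1 fM] fs]; have fI := can_inj fK.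
split=> [a x y||x].
- by apply: fI; rewrite fl !gK.
- by split=> [|x y]; apply: fI; rewrite ?fM ?f1 !gK.
- by apply: fI; rewrite fs !gK.
Qed.

Definition star_aut_one : star_aut :=
  StarAut unital_star_hom_id (Bijective (fun=> erefl) (fun=> erefl)).

Definition star_aut_mul (f g : star_aut) : star_aut :=
  StarAut (unital_star_hom_comp (star_aut_hom f) (star_aut_hom g))
          (bij_comp (star_aut_bij f) (star_aut_bij g)).

Lemma star_aut_inv_subproof (f : star_aut) :
  {g : star_aut | cancel f g /\ cancel g f}.
Proof.
apply: cid; case: (star_aut_bij f) => g fK gK.
by exists (StarAut (unital_star_hom_can fK gK (star_aut_hom f))
                   (Bijective gK fK)).
Qed.

Definition star_aut_inv (f : star_aut) : star_aut :=
  sval (star_aut_inv_subproof f).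

Lemma star_aut_mulA : associative star_aut_mul.
Proof. by move=> f g h; apply: star_autP. Qed.

Lemma star_aut_mul1 : left_id star_aut_one star_aut_mul.
Proof. by move=> f; apply: star_autP. Qed.

Lemma star_aut_mulr1 : right_id star_aut_one star_aut_mul.
Proof. by move=> f; apply: star_autP. Qed.

Lemma star_aut_mulV : left_inverse star_aut_one star_aut_inv star_aut_mul.
Proof.
move=> f; apply: star_autP => x /=; rewrite /star_aut_inv.
by case: star_aut_inv_subproof => g [fK gK] /=; rewrite fK.
Qed.

Lemma star_aut_mulrV : right_inverse star_aut_one star_aut_inv star_aut_mul.
Proof.
move=> f; apply: star_autP => x /=; rewrite /star_aut_inv.
by case: star_aut_inv_subproof => g [fK gK] /=; rewrite gK.
Qed.

HB.instance Definition _ := isGroup.Build star_aut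
  star_aut_mulA star_aut_mul1 star_aut_mulr1 star_aut_mulV star_aut_mulrV.

(** [Aut_D(A)], for an arbitrary subset [D] of [A]. *)
Definition Aut_fixing (D : set A) : set star_aut :=
  [set f | forall x, D x -> f x = x].

End automorphism_group.

Definition subgroup (G : groupType) (H : set G) : Prop :=
  [/\ H 1%g,
      forall x y : G, H x -> H y -> H (x * y)%g
    & forall x : G, H x -> H (x^-1)%g].

Definition abelian_set (G : groupType) (H : set G) : Prop :=
  forall x y : G, H x -> H y -> (x * y = y * x)%g.

Definition maximal_abelian (G : groupType) (H : set G) : Prop :=
  [/\ subgroup H, abelian_set H
    & forall K : set G, subgroup K -> abelian_set K -> ~ (H `<` K)].

Section two_adic_ring_algebra.
Variable R : realType.

(** The defining relations of [Q_2] for [S_2 = s] and [U = u]. *)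
Definition Q2_relations (A : cstarType R) (s u : A) : Prop :=
  [/\ star s * s = 1,
      star u * u = 1 /\ u * star u = 1,
      s * star s + u * s * star s * star u = 1
    & s * u = u ^+ 2 * s].

(** [A], generated by [s] and [u], is the universal unital C*-algebra for these
    relations; this determines [(A, s, u)] up to a unique *-isomorphism. *)
Definition is_Q2 (A : cstarType R) (s u : A) : Prop :=
  [/\ Q2_relations s u,
      cstar_generated [set 1; s; u] = setT
    & forall (B : cstarType R) (t v : B), Q2_relations t v ->
        exists f : A -> B, [/\ unital_star_hom f, f s = t & f u = v]].

Inductive letter := One | Two.

Definition Q2_gen (A : cstarType R) (s u : A) (i : letter) : A :=
  match i with One => u * s | Two => s end.

Definition Q2_word (A : cstarType R) (s u : A) (alpha : seq letter) : A :=
  \prod_(i <- alpha) Q2_gen s u i.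

Definition Q2_proj (A : cstarType R) (s u : A) (alpha : seq letter) : A :=
  Q2_word s u alpha * star (Q2_word s u alpha).

(** The empty word is allowed; it contributes [1], which is also the sum of the
    projections of the two words of length one. *)
Definition Q2_diagonal (A : cstarType R) (s u : A) : set A :=
  cstar_generated (range (Q2_proj s u)).

End two_adic_ring_algebra.

(* Main.v *)
From HB Require Import structures.
Require Import Defs.
From mathcomp Require Import all_boot all_order all_algebra.
From mathcomp Require Import all_classical all_reals all_analysis.
From mathcomp Require Import complex ring lra zify.

(** The projections [cyl c k = U^c S^k S*^k U*^c] are the [P_alpha] with
    [|alpha| = k]; [cyl c k] corresponds to the residue class of [c] modulo [2^k]
    in the 2-adic integers.  The main point is that the commutant of the diagonal
    is "locally scalar": if [x] commutes with all [cyl c k], then for every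
    [e > 0] there is a level [k] at which each [x * cyl c k] is within [e] of a
    multiple of [cyl c k].

    The linear span of the monomials [U^a S^i S*^j U*^b] is dense, and such a
    monomial acts on the 2-adic integers as a partial affine map of slope
    [2^(i - j)].  The gauge automorphisms [S -> z S], [U -> U], averaged over roots
    of unity, split [x] into components of degree [i - j], which still commute
    with the diagonal.  In degree 0 only translations occur, and they move small
    cylinders off themselves, so this component is locally scalar.  In degree
    [m <> 0] every cylinder has a subcylinder that is moved off itself (fixed
    points are isolated); there the component [v] is small, and since [v* v] has
    degree 0 it is locally scalar, hence small everywhere.  Fejer means then show
    that [x] is the limit of its degree-0 components.

    An automorphism [f] fixing the diagonal is determined by [U* f(U)] and
    [f(S) S*], which commute with the diagonal; local scalarity shows that such
    elements commute and are fixed by every automorphism of this kind, so these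
    automorphisms commute.  Conversely, if [f] commutes with [Ad(d)] for the
    diagonal unitary [d = 1 + (z - 1) p], then [d* f(d)] is central; taking
    [z = -1] and [z = i] forces [f(p) = p]. *)

Set Implicit Arguments.
Unset Strict Implicit.
Unset Printing Implicit Defensive.

Import Order.TTheory GRing.Theory Num.Theory.
Import numFieldNormedType.Exports.

Local Open Scope classical_set_scope.
Local Open Scope ring_scope.
Local Open Scope complex_scope.

(** * Norms and *-homomorphisms *)

Section Norm.
Variables (R : realType) (A : cstarType R).
Implicit Types x y : A.

(** The norm takes values in [R[i]]; its real part carries all of it and lives in a totally ordered
    field. *)
Definition nrm x : R := complex.Re `|x|.
Definition cabs (a : R[i]) : R := complex.Re `|a|.

Lemma nrmE x : `|x| = (nrm x)%:C.
Proof. by rewrite /nrm RRe_real// normr_real. Qed.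

Lemma cabsE (a : R[i]) : `|a| = (cabs a)%:C.
Proof. by rewrite /cabs RRe_real// normr_real. Qed.

Lemma nrm_ge0 x : 0 <= nrm x.
Proof. by rewrite -lecR -nrmE normr_ge0. Qed.

Lemma cabs_ge0 a : 0 <= cabs a.
Proof. by rewrite -lecR -cabsE normr_ge0. Qed.

Lemma nrm0 : nrm 0 = 0. Proof. by rewrite /nrm normr0. Qed.

Lemma nrm_eq0 x : nrm x = 0 -> x = 0.
Proof. by move=> x0; apply/normr0_eq0; rewrite nrmE x0. Qed.

Lemma nrmN x : nrm (- x) = nrm x. Proof. by rewrite /nrm normrN. Qed.

Lemma nrmB x y : nrm (x - y) = nrm (y - x). Proof. by rewrite -nrmN opprB. Qed.

Lemma nrmD x y : nrm (x + y) <= nrm x + nrm y.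
Proof. by rewrite -lecR rmorphD/= -!nrmE ler_normD. Qed.

Lemma nrm_tri y x z : nrm (x - z) <= nrm (x - y) + nrm (y - z).
Proof. by rewrite (le_trans _ (nrmD _ _))// addrA subrK. Qed.

Lemma nrmM x y : nrm (x * y) <= nrm x * nrm y.
Proof. by rewrite -lecR rmorphM/= -!nrmE cstar_normrM. Qed.

Lemma nrmZ a x : nrm (a *: x) = cabs a * nrm x.
Proof. by apply: complexI; rewrite rmorphM/= -nrmE -cabsE -nrmE normrZ. Qed.

Lemma nrm_approx_eq x y : (forall e : R, 0 < e -> nrm (x - y) <= e) -> x = y.
Proof.
move=> xy; apply/eqP; rewrite -subr_eq0; apply/eqP/nrm_eq0/le_anti.
by rewrite nrm_ge0 andbT; apply/ler_addgt0Pr => e /xy; rewrite add0r.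
Qed.

Lemma cabs_natV n : cabs (n%:R^-1) = n%:R^-1.
Proof.
by apply: complexI; rewrite -cabsE ger0_norm ?invr_ge0 ?ler0n// fmorphV rmorph_nat.
Qed.

Lemma nrm_sum (I : Type) (r : seq I) (P : pred I) (F : I -> A) :
  nrm (\sum_(i <- r | P i) F i) <= \sum_(i <- r | P i) nrm (F i).
Proof.
elim/big_rec2: _ => [|i y x _ le_xy]; first by rewrite nrm0.
by rewrite (le_trans (nrmD _ _))// lerD2l.
Qed.

Lemma nrm_sqr x : nrm (star x * x) = nrm x ^+ 2.
Proof. by apply: complexI; rewrite rmorphXn/= -!nrmE cstar_identity. Qed.

Lemma star0 : star (0 : A) = 0.
Proof. by rewrite -(scale0r (0 : A)) starZ conjC0 !scale0r. Qed.

Lemma starN x : star (- x) = - star x.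
Proof. by rewrite -scaleN1r starZ rmorphN1 scaleN1r. Qed.

Lemma starB x y : star (x - y) = star x - star y.
Proof. by rewrite starD starN. Qed.

Lemma star1 : star (1 : A) = 1.
Proof. by rewrite -[LHS]mulr1 -{2}(starK 1) -starM mulr1 starK. Qed.

Lemma starX x n : star (x ^+ n) = star x ^+ n.
Proof. by elim: n => [|n IH]; rewrite ?star1// exprS starM IH exprSr. Qed.

(** The C*-identity gives [|x|^2 = |star x * x| <= |star x| |x|]; divide by [|x|]. *)
Lemma nrm_le_star x : nrm x <= nrm (star x).
Proof.
have [->|x0] := eqVneq (nrm x) 0; first exact: nrm_ge0.
rewrite -(ler_pM2r (x := nrm x)) ?lt0r ?x0 ?nrm_ge0//.
by rewrite -expr2 -nrm_sqr nrmM.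
Qed.

Lemma nrm_star x : nrm (star x) = nrm x.
Proof. by apply/le_anti; rewrite -{2}(starK x) !nrm_le_star. Qed.

Lemma nrm1 : nrm (1 : A) = 1.
Proof.
have n0 : nrm (1 : A) != 0.
  by apply/eqP => /nrm_eq0 /eqP; rewrite oner_eq0.
by apply: (mulfI n0); rewrite mulr1 -expr2 -nrm_sqr star1 mulr1.
Qed.

Lemma nrm_isometry v : star v * v = 1 -> nrm v = 1.
Proof.
move=> v1; have := nrm_sqr v; rewrite v1 nrm1 => /esym/eqP.
by rewrite sqrf_eq1 => /orP[/eqP//|/eqP v_neg]; have := nrm_ge0 v; lra.
Qed.

Lemma nrm_mulr_le1 x y : nrm y <= 1 -> nrm (x * y) <= nrm x.
Proof.
by move=> y1; rewrite (le_trans (nrmM _ _))// ler_piMr// nrm_ge0.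
Qed.

Lemma nrm_mull_le1 x y : nrm x <= 1 -> nrm (x * y) <= nrm y.
Proof.
by move=> y1; rewrite (le_trans (nrmM _ _))// ler_piMl// nrm_ge0.
Qed.

Lemma closureP (X : set A) x :
  closure X x <-> forall e : R, 0 < e -> exists2 y, X y & nrm (x - y) < e.
Proof.
split=> [clX e e0|clX].
  have e0C : 0 < e%:C by rewrite ltcR.
  have [y [Xy]] := clX _ (nbhsx_ballx x _ e0C).
  by rewrite -ball_normE/= nrmE ltcR; exists y.
move=> B /nbhs_normP[e /= e0 eB].
have er : e = (complex.Re e)%:C by rewrite RRe_real// gtr0_real.
have [|y Xy xy] := clX (complex.Re e); first by rewrite -ltcR -er.
by exists y; split=> //; apply: eB; rewrite /= nrmE er ltcR.
Qed.

Lemma closedP (X : set A) :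
  (forall x, (forall e : R, 0 < e -> exists2 y, X y & nrm (x - y) < e) -> X x) ->
  closed X.
Proof. by move=> clX x /closureP; exact: clX. Qed.

End Norm.

Lemma expr_small (R : realType) (r e : R) :
  0 <= r -> r < 1 -> 0 < e -> exists N, r ^+ N < e.
Proof.
move=> r0 r1 e0; have := @cvg_expr R r; rewrite ger0_norm// => /(_ r1).
move=> /cvgr0Pnorm_lt/(_ _ e0)[N _ /(_ N (leqnn N))/=].
by rewrite ger0_norm ?exprn_ge0//; exists N.
Qed.

(** * Limits of Cauchy sequences and square roots *)

Section Completeness.
Variables (R : realType) (A : cstarType R).

Lemma cauchy_limit (y : nat -> A) :
  (forall e : R, 0 < e -> exists N, forall n m,
     (N <= n)%N -> (N <= m)%N -> nrm (y n - y m) < e) ->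
  exists l : A, forall e : R, 0 < e -> exists N, forall n,
     (N <= n)%N -> nrm (y n - l) < e.
Proof.
move=> cauchy; have y_cvg : cvgn y.
  apply/cauchy_cvgP; apply/cauchy_ballP => e e0; near_simpl.
  have er : e = (complex.Re e)%:C by rewrite RRe_real// gtr0_real.
  have /cauchy[N yN] : 0 < complex.Re e by rewrite -ltcR -er.
  exists ([set n | (N <= n)%N], [set n | (N <= n)%N]); first by split; exists N.
  by case=> n m /= [Nn Nm]; rewrite -ball_normE/= nrmE er ltcR yN.
exists (limn y) => e e0.
have e0C : 0 < e%:C by rewrite ltcR.
have /cvgrPdist_lt/(_ _ e0C)[N _ yN] := y_cvg.
by exists N => n /yN /=; rewrite nrmE ltcR nrmB.
Qed.

(* The iterates y <- (a^2 + y^2)/2 converge to y = 1 - sqrt(1 - a^2). *)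
Lemma sqrt_one_sub_sqr (a : A) : star a = a -> nrm a < 1 ->
  exists b : A, [/\ star b = b, a * b = b * a & a * a + b * b = 1].
Proof.
move=> sa a1; set r := nrm a in a1; have r0 : 0 <= r := nrm_ge0 a.
pose f (y : A) := 2^-1 *: (a * a + y * y).
pose y n := iter n f 0.
have c2 : cabs (2^-1 : R[i]) = 2^-1 by exact: cabs_natV.
have yS n : star (y n) = y n.
  elim: n => [|n IH]; first exact: star0.
  rewrite /y /= -/(y n) /f starZ starD !starM IH sa.
  by rewrite (geC0_conj _) ?invr_ge0 ?ler0n.
have ya n : a * y n = y n * a.
  elim: n => [|n IH]; first by rewrite mulr0 mul0r.
  rewrite /y /= -/(y n) /f -scalerAr -scalerAl mulrDr mulrDl mulrA.
  by congr (_ *: (_ + _)); rewrite mulrA IH -mulrA IH mulrA.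
have yy n m : y n * y m = y m * y n.
  elim: n => [|n IH]; first by rewrite mulr0 mul0r.
  rewrite /y /= -/(y n) -/(y m) /f -scalerAr -scalerAl mulrDr mulrDl.
  congr (_ *: (_ + _)); first by rewrite -mulrA ya mulrA ya mulrA.
  by rewrite -mulrA IH mulrA IH mulrA.
have yr n : nrm (y n) <= r.
  elim: n => [|n IH]; first by rewrite nrm0.
  rewrite /y /= -/(y n) /f nrmZ c2.
  have := nrmD (a * a) (y n * y n); have := nrmM a a; have := nrmM (y n) (y n).
  rewrite -/r; have := nrm_ge0 (y n); nra.
(* The iterates commute, so a difference of squares factors; the sum has norm at most [2 * r], and
   halving leaves the contraction factor [r]. *)
have ydist n k : nrm (y (n + k)%N - y n) <= r ^+ n.
  elim: n => [|n IH].
    by rewrite expr0 /y /= subr0 -/(y k) (le_trans (yr _))// ltW.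
  rewrite /y addSn /= -/(y n) -/(y (n + k)%N) /f -scalerBr opprD addrACA subrr add0r.
  have -> : y (n + k)%N * y (n + k)%N - y n * y n =
      (y (n + k)%N - y n) * (y (n + k)%N + y n).
    by rewrite mulrDr !mulrBl (yy (n + k)%N n) addrA subrK.
  rewrite nrmZ c2 exprS ler_pdivrMl// (le_trans (nrmM _ _))//.
  have sumr : nrm (y (n + k)%N + y n) <= 2 * r.
    by have := nrmD (y (n + k)%N) (y n); have := yr n; have := yr (n + k)%N; lra.
  by rewrite mulrA mulrC ler_pM ?nrm_ge0.
have [l yl] : exists l : A, forall e : R, 0 < e -> exists N, forall n,
     (N <= n)%N -> nrm (y n - l) < e.
  apply: cauchy_limit => e e0.
  have [|N rN] := expr_small r0 a1 (_ : 0 < e / 2); first by lra.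
  exists N => n m Nn Nm.
  have := ydist N (n - N)%N; have := ydist N (m - N)%N.
  rewrite !subnKC// (nrmB (y m)).
  by have := nrm_tri (y N) (y n) (y m); lra.
(* Passage to the limit: each identity for [l] below has a defect bounded by the errors of two
   successive iterates. *)
have lim0 (x : A) K :
    (forall n, nrm x <= K * (nrm (y n - l) + nrm (y n.+1 - l))) -> x = 0.
  move=> xK; apply: nrm_approx_eq => e e0; rewrite subr0.
  have [k [k0 Kk]] : exists k : R, 0 <= k /\ K <= k.
    by exists `|K|; rewrite normr_ge0 ler_norm.
  pose B : R := 2 * (k + 1).
  have B0 : 0 < B by rewrite mulr_gt0// ltr_wpDl.
  have [N yN] := yl (e / B) (divr_gt0 e0 B0).
  have /ltW := yN N (leqnn N); have /ltW := yN N.+1 (leqnSn N).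
  rewrite !ler_pdivlMr// => h1 h2; rewrite (le_trans (xK N))//.
  have := nrm_ge0 (y N - l); have := nrm_ge0 (y N.+1 - l).
  move: (nrm (y N - l)) (nrm (y N.+1 - l)) h1 h2 => d' d h1 h2 d0 d'0.
  rewrite (le_trans (_ : _ <= k * (d' + d)))//.
    by rewrite ler_wpM2r// addr_ge0.
  by rewrite /B in h1 h2; lra.
have sl : star l = l.
  apply/eqP; rewrite -subr_eq0; apply/eqP; apply: (lim0 _ 2) => n.
  have := nrm_tri (y n) (star l) l; rewrite -{1}(yS n) -starB nrm_star (nrmB l).
  by have := nrm_ge0 (y n.+1 - l); lra.
have al : a * l = l * a.
  apply/eqP; rewrite -subr_eq0; apply/eqP; apply: (lim0 _ (2 * r)) => n.
  have -> : a * l - l * a = (y n - l) * a - a * (y n - l).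
    by rewrite mulrBl mulrBr ya opprB [RHS]addrC subrKA.
  have := nrmD ((y n - l) * a) (- (a * (y n - l))); rewrite nrmN.
  have := nrmM a (y n - l); have := nrmM (y n - l) a; rewrite -/r.
  have := nrm_ge0 (y n.+1 - l); nra.
have yl_comm n : y n * l = l * y n.
  elim: n => [|n IH]; first by rewrite mulr0 mul0r.
  rewrite /y /= -/(y n) /f -scalerAr -scalerAl mulrDr mulrDl.
  congr (_ *: (_ + _)); first by rewrite -mulrA al mulrA al mulrA.
  by rewrite -mulrA IH mulrA IH mulrA.
have lf : l = f l.
  apply/eqP; rewrite -subr_eq0; apply/eqP; apply: (lim0 _ (1 + r + nrm l)) => n.
  have := nrm_tri (y n.+1) l (f l); rewrite (nrmB l (y n.+1)).
  rewrite [y n.+1 in X in _ <= _ + X]/y /= -/(y n) /f -scalerBr opprD addrACA subrr add0r.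
  have -> : y n * y n - l * l = (y n - l) * (y n + l).
    by rewrite mulrDr !mulrBl yl_comm addrA subrK.
  rewrite nrmZ c2 => /le_trans; apply.
  have suml : nrm (y n + l) <= r + nrm l.
    by have := nrmD (y n) l; have := yr n; lra.
  have : nrm ((y n - l) * (y n + l)) <= nrm (y n - l) * (r + nrm l).
    by rewrite (le_trans (nrmM _ _))// ler_wpM2l ?nrm_ge0.
  have := nrm_ge0 (y n - l); have := nrm_ge0 (y n.+1 - l).
  have := nrm_ge0 ((y n - l) * (y n + l)).
  have rl : 0 <= r + nrm l by rewrite addr_ge0 ?nrm_ge0.
  have := mulr_ge0 rl (nrm_ge0 (y n.+1 - l)).
  by lra.
exists (1 - l); split.
- by rewrite starB star1 sl.
- by rewrite mulrBl mulrBr al mulr1 mul1r.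
- rewrite mulrBl !mulrBr !mulr1 !mul1r.
  have : l + l = a * a + l * l.
    by rewrite -mulr2n -scaler_nat {1}lf /f scalerA mulfV ?scale1r// pnatr_eq0.
  move=> ll; rewrite -(addrK (l * l) (a * a)) -ll.
  have -> : 1 - l - (l - l * l) = 1 - (l + l - l * l) by rewrite !opprD !addrA.
  by rewrite addrC subrK.
Qed.

End Completeness.

(** * Contractivity of *-homomorphisms *)

Section Hom.
Variables (R : realType) (A B : cstarType R) (f : A -> B).
Hypothesis fhom : unital_star_hom f.

Lemma homP a x y : f (a *: x + y) = a *: f x + f y.
Proof. by case: fhom => fl _ _; exact: fl. Qed.

Lemma homM x y : f (x * y) = f x * f y.
Proof. by case: fhom => _ [_ fM] _; exact: fM. Qed.

Lemma hom1 : f 1 = 1.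
Proof. by case: fhom => _ [f1 _] _; exact: f1. Qed.

Lemma hom_star x : f (star x) = star (f x).
Proof. by case: fhom => _ _ fs; exact: fs. Qed.

Lemma homD x y : f (x + y) = f x + f y.
Proof. by rewrite -[x in LHS]scale1r homP scale1r. Qed.

Lemma hom0 : f 0 = 0.
Proof. by apply: (addrI (f 0)); rewrite -homD !addr0. Qed.

Lemma homZ a x : f (a *: x) = a *: f x.
Proof. by rewrite -[a *: x]addr0 homP hom0 addr0. Qed.

Lemma homB x y : f (x - y) = f x - f y.
Proof. by rewrite -scaleN1r addrC homP scaleN1r addrC. Qed.

Lemma homX x n : f (x ^+ n) = f x ^+ n.
Proof. by elim: n => [|n IH]; rewrite ?hom1// !exprS homM IH. Qed.

(* A self-adjoint a with |a| < 1 is the real part of the unitary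
   a + i sqrt(1 - a^2), whose image under f has norm 1. *)
Lemma hom_selfadjoint_ball a : star a = a -> nrm a < 1 -> nrm (f a) <= 1.
Proof.
move=> sa /(sqrt_one_sub_sqr sa)[b [sb ab ab1]].
pose h := f a; pose g := f b; pose v := h + 'i *: g.
have sh : star h = h by rewrite -hom_star sa.
have sg : star g = g by rewrite -hom_star sb.
have hg : h * g = g * h by rewrite -!homM ab.
have hhgg : h * h + g * g = 1 by rewrite -!homM -homD ab1 hom1.
have sv : star v = h - 'i *: g by rewrite starD starZ conjCi sh sg scaleNr.
have ii : ('i : R[i]) * 'i = -1 by rewrite -expr2 sqrCi.
have v1 : star v * v = 1.
  rewrite sv /v mulrBl !mulrDr -!scalerAl -!scalerAr scalerA ii scaleN1r hg.
  by rewrite opprD opprK addrA addrK.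
have -> : f a = 2^-1 *: (v + star v).
  rewrite sv /v addrACA subrr addr0 -(mulr2n h) -(scaler_nat 2 h) scalerA.
  by rewrite mulVf ?scale1r// pnatr_eq0.
have c2 : cabs (2^-1 : R[i]) = 2^-1 by exact: cabs_natV.
rewrite nrmZ c2; have := nrmD v (star v); rewrite nrm_star (nrm_isometry v1).
lra.
Qed.

(** Self-adjoint elements are scaled by [(nrm a + e)^-1] into the open unit ball; the general case
    applies this to [star x * x]. *)
Lemma hom_nrm x : nrm (f x) <= nrm x.
Proof.
have selfadj a : star a = a -> nrm (f a) <= nrm a.
  move=> sa; apply/ler_addgt0Pr => e e0.
  have t0 : 0 < nrm a + e by rewrite ltr_wpDl ?nrm_ge0.
  pose c : R[i] := (nrm a + e)^-1%:C.
  have c_ge0 : 0 <= c by rewrite ler0c invr_ge0 ltW.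
  have cc : cabs c = (nrm a + e)^-1.
    by apply: complexI; rewrite -cabsE ger0_norm.
  have sca : star (c *: a) = c *: a by rewrite starZ sa geC0_conj.
  have := hom_selfadjoint_ball sca; rewrite nrmZ cc homZ nrmZ cc.
  rewrite mulrC ltr_pdivrMr// mul1r ltrDl e0 => /(_ isT).
  by rewrite mulrC ler_pdivrMr// mul1r.
rewrite -(ler_pXn2r (n := 2))// ?nnegrE ?nrm_ge0// -!nrm_sqr -hom_star -homM.
by apply: selfadj; rewrite starM starK.
Qed.

End Hom.

(** Otherwise [(t / x)^(2^n)] would tend to 0 while staying at least [1/2]: a constant factor
    disappears under roots of growing order. *)
Lemma pow2_le (R : realType) (x t : R) : 0 <= x -> 0 <= t ->
  (forall n, x ^+ (2 ^ n) <= 2 * t ^+ (2 ^ n)) -> x <= t.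
Proof.
move=> x0 t0 xt; rewrite leNgt; apply/negP => tx.
have x_gt0 : 0 < x by exact: le_lt_trans tx.
have r0 : 0 <= t / x by rewrite divr_ge0.
have r1 : t / x < 1 by rewrite ltr_pdivrMr// mul1r.
have [|N rN] := expr_small r0 r1 (_ : 0 < 2^-1); first by rewrite invr_gt0.
have rN2 : (t / x) ^+ (2 ^ N) < 2^-1.
  by rewrite (le_lt_trans _ rN)// ler_wiXn2l ?(ltW r1)// (ltnW (ltn_expl _ _)).
have := xt N; rewrite leNgt => /negP; apply.
by rewrite expr_div_n ltr_pdivrMr ?exprn_gt0// ltr_pdivlMl in rN2.
Qed.

(** * Norms of orthogonal sums *)

Section Orthogonal.
Variables (R : realType) (A : cstarType R).
Implicit Types h k b c : A.

Lemma nrm_selfadj_pow2 h n : star h = h -> nrm (h ^+ (2 ^ n)) = nrm h ^+ (2 ^ n).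
Proof.
move=> sh; elim: n => [|n IH]; first by rewrite !expr1.
by rewrite expnS mulnC !exprM -IH -nrm_sqr starX sh expr2.
Qed.

(** Powers of an orthogonal sum split, so [(h + k)^(2^n)] has norm at most [2 t^(2^n)], and
    [pow2_le] removes the 2. *)
Lemma nrm_selfadj_orth h k t : star h = h -> star k = k -> h * k = 0 ->
  nrm h <= t -> nrm k <= t -> nrm (h + k) <= t.
Proof.
move=> sh sk hk ht kt.
have kh : k * h = 0 by rewrite -sh -sk -starM hk star0.
have pow m : (h + k) ^+ m.+1 = h ^+ m.+1 + k ^+ m.+1.
  elim: m => [|m IH]; first by rewrite !expr1.
  have hkm : h * k ^+ m.+1 = 0 by rewrite exprS mulrA hk mul0r.
  have khm : k * h ^+ m.+1 = 0 by rewrite exprS mulrA kh mul0r.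
  by rewrite exprS IH mulrDl !mulrDr hkm khm addr0 add0r -!exprS.
have t0 : 0 <= t by exact: le_trans (nrm_ge0 h) ht.
apply: pow2_le => // [|n]; first exact: nrm_ge0.
rewrite -nrm_selfadj_pow2 ?starD ?sh ?sk//.
have n0 : (0 < 2 ^ n)%N by rewrite expn_gt0.
rewrite -(prednK n0) pow (le_trans (nrmD _ _))// prednK// !nrm_selfadj_pow2//.
rewrite mulr_natl mulr2n lerD// lerXn2r ?nnegrE ?nrm_ge0//.
Qed.

(** The first hypothesis removes the cross terms of [star (b + c) * (b + c)]; the second makes
    [star b * b] and [star c * c] orthogonal. *)
Lemma nrm_orth b c t : star b * c = 0 -> b * star c = 0 ->
  nrm b <= t -> nrm c <= t -> nrm (b + c) <= t.
Proof.
move=> bc bc' bt ct; have t0 : 0 <= t by exact: le_trans (nrm_ge0 b) bt.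
have cb : star c * b = 0 by rewrite -(starK b) -starM bc star0.
rewrite -(ler_pXn2r (n := 2))// ?nnegrE ?nrm_ge0// -nrm_sqr.
rewrite starD mulrDl !mulrDr bc cb addr0 add0r.
apply: nrm_selfadj_orth; rewrite ?starM ?starK//.
- by rewrite -mulrA (mulrA b) bc' mul0r mulr0.
- by rewrite nrm_sqr lerXn2r ?nnegrE ?nrm_ge0.
- by rewrite nrm_sqr lerXn2r ?nnegrE ?nrm_ge0.
Qed.

End Orthogonal.

(** * Cylinder projections and monomials *)

Section Relations.
Variables (R : realType) (A : cstarType R) (s u : A).
Hypothesis rel : Q2_relations s u.
Implicit Types (a b c d e i j k m n : nat) (x y : A).

Local Notation s' := (star s).
Local Notation u' := (star u).

Lemma ss1 : s' * s = 1. Proof. by case: rel. Qed.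
Lemma uu1 : u' * u = 1. Proof. by case: rel => _ []. Qed.
Lemma uu1r : u * u' = 1. Proof. by case: rel => _ []. Qed.

Lemma suE : s * u = u ^+ 2 * s. Proof. by case: rel. Qed.

Lemma range_sum : s * s' + u * s * s' * u' = 1. Proof. by case: rel. Qed.

Lemma uXK n : u' ^+ n * u ^+ n = 1.
Proof.
elim: n => [|n IH]; first by rewrite mulr1.
by rewrite exprSr exprS mulrA -(mulrA _ u') uu1 mulr1.
Qed.

Lemma uXKr n : u ^+ n * u' ^+ n = 1.
Proof.
elim: n => [|n IH]; first by rewrite mulr1.
by rewrite exprSr exprS mulrA -(mulrA _ u) uu1r mulr1.
Qed.

Lemma sXK n : s' ^+ n * s ^+ n = 1.
Proof.
elim: n => [|n IH]; first by rewrite mulr1.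
by rewrite exprSr exprS mulrA -(mulrA _ s') ss1 mulr1.
Qed.

Lemma sXuX k n : s ^+ k * u ^+ n = u ^+ (2 ^ k * n) * s ^+ k.
Proof.
have su m : s * u ^+ m = u ^+ (2 * m) * s.
  elim: m => [|m IH]; first by rewrite !expr0 mulr1 mul1r.
  by rewrite exprSr mulrA IH -mulrA suE mulrA -exprD mulnS addnC.
elim: k => [|k IH] in n *; first by rewrite !expr0 mul1r mulr1 expn0 mul1n.
by rewrite exprSr -mulrA su mulrA IH -mulrA -exprSr mulnA -expnSr.
Qed.

Lemma sXuX' k n : s ^+ k * u' ^+ n = u' ^+ (2 ^ k * n) * s ^+ k.
Proof.
rewrite -[LHS]mul1r -(uXK (2 ^ k * n)) -mulrA; congr (_ * _).
by rewrite mulrA -sXuX -mulrA uXKr mulr1.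
Qed.

Lemma uXsX' k n : u ^+ n * s' ^+ k = s' ^+ k * u ^+ (2 ^ k * n).
Proof.
by have := congr1 (@star R A) (sXuX' k n); rewrite !starM !starX !starK.
Qed.

Lemma uX'sX' k n : u' ^+ n * s' ^+ k = s' ^+ k * u' ^+ (2 ^ k * n).
Proof. by have := congr1 (@star R A) (sXuX k n); rewrite !starM !starX. Qed.

(** Compressing [range_sum] by [s] shows that [s' u s] times its adjoint is 0: the ranges of [s] and
    [u s] are orthogonal. *)
Lemma sus0 : s' * u * s = 0.
Proof.
have := congr1 (fun x => s' * x * s) range_sum; rewrite mulr1 ss1 mulrDr mulrDl.
rewrite !mulrA ss1 mul1r ss1 => /eqP; rewrite eq_sym -subr_eq0 opprD addrA subrr.
rewrite add0r oppr_eq0 => /eqP sq0; apply/nrm_eq0/eqP.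
rewrite -nrm_star -sqrf_eq0 -nrm_sqr starK !starM starK !mulrA sq0.
by rewrite nrm0.
Qed.

Lemma uXs' e : s' * u ^+ (2 * e) = u ^+ e * s'.
Proof. by have := uXsX' 1 e; rewrite !expr1 expn1. Qed.

Lemma sus_even e : s' * u ^+ (2 * e) * s = u ^+ e.
Proof. by rewrite uXs' -mulrA ss1 mulr1. Qed.

Lemma sus_odd e : s' * u ^+ (2 * e).+1 * s = 0.
Proof. by rewrite exprSr mulrA uXs' -!mulrA (mulrA s') sus0 mulr0. Qed.

(** Each compression by [s] halves an even exponent and gives 0 on an odd one, so only multiples of
    [2^k] survive [k] steps. *)
Lemma sXuXsX k d : ~~ (2 ^ k %| d)%N -> s' ^+ k * u ^+ d * s ^+ k = 0.
Proof.
elim: k => [|k IH] in d *; first by rewrite expn0 dvd1n.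
rewrite exprSr exprS -!mulrA (mulrA (u ^+ d)) (mulrA s') (mulrA s' (u ^+ d)).
rewrite -(odd_double_half d) -mul2n; case: (odd d).
  by rewrite add1n sus_odd mul0r mulr0.
rewrite add0n sus_even mulrA => ndvd; apply: IH; apply: contra ndvd.
by rewrite expnS dvdn_pmul2l.
Qed.

(* Locked because rewriting with mulrA would otherwise unfold it. *)
Definition cyl c k : A := locked (u ^+ c * s ^+ k * s' ^+ k * u' ^+ c).

Lemma cylE c k : cyl c k = u ^+ c * s ^+ k * s' ^+ k * u' ^+ c.
Proof. by rewrite /cyl -lock. Qed.

Lemma cyl0 c : cyl c 0 = 1.
Proof. by rewrite !cylE !mulr1 uXKr. Qed.

Lemma star_cyl c k : star (cyl c k) = cyl c k.
Proof. by rewrite !cylE !starM !starX !starK !mulrA. Qed.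

Lemma cyl_period c k n : cyl (c + 2 ^ k * n) k = cyl c k.
Proof.
rewrite !cylE exprD -(mulrA (u ^+ c)) -sXuX [(c + _)%N]addnC [u' ^+ (_ + _)]exprD.
rewrite mulrA -(mulrA _ (s' ^+ k) (u' ^+ _)) -uX'sX'.
by rewrite !mulrA -(mulrA (u ^+ c * s ^+ k)) uXKr mulr1.
Qed.

Lemma cyl_mod c c' k : (c = c' %[mod 2 ^ k])%N -> cyl c k = cyl c' k.
Proof.
move=> cc'; rewrite (divn_eq c (2 ^ k)) (divn_eq c' (2 ^ k)) cc'.
by rewrite ![(_ %/ _ * _ + _)%N]addnC ![(_ %/ _ * _)%N]mulnC !cyl_period.
Qed.

(** Insert [range_sum] between [s^k] and [s'^k]: a class modulo [2^k] is the union of two classes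
    modulo [2^(k+1)]. *)
Lemma cyl_split c k : cyl c k = cyl c k.+1 + cyl (c + 2 ^ k) k.+1.
Proof.
rewrite {1}cylE -[in LHS](mulr1 (_ * s ^+ k)) -range_sum mulrDr !mulrDl.
congr (_ + _); first by rewrite !cylE exprSr exprS !mulrA.
have e1 : u ^+ c * s ^+ k * (u * s) = u ^+ (c + 2 ^ k) * s ^+ k.+1.
  have := sXuX k 1; rewrite expr1 muln1 => sXu.
  by rewrite !mulrA -(mulrA (u ^+ c)) sXu exprD exprSr !mulrA.
have e2 : s' * u' * (s' ^+ k * u' ^+ c) = s' ^+ k.+1 * u' ^+ (c + 2 ^ k).
  have := uX'sX' k 1; rewrite expr1 muln1 => usX.
  by rewrite -!mulrA (mulrA u') usX addnC exprD exprS !mulrA.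
by rewrite !cylE -[RHS]mulrA -e1 -e2 !mulrA.
Qed.

Lemma cyl_id c k : cyl c k * cyl c k = cyl c k.
Proof.
rewrite !cylE !mulrA -(mulrA _ (u' ^+ c) (u ^+ c)) uXK mulr1.
by rewrite -(mulrA _ (s' ^+ k) (s ^+ k)) sXK mulr1.
Qed.

Lemma cyl_orth c c' k : (c != c' %[mod 2 ^ k])%N -> cyl c k * cyl c' k = 0.
Proof.
wlog cc' : c c' / (c <= c')%N => [W|ncc'].
  have [|/ltnW cc' ncc'] := leqP c c'; first exact: W.
  by rewrite -(starK (_ * _)) starM !star_cyl W ?star0// eq_sym.
suff z : s' ^+ k * (u' ^+ c * u ^+ c') * s ^+ k = 0.
  rewrite !cylE -!mulrA (mulrA (u' ^+ c)) (mulrA (s' ^+ k) (_ * _)).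
  by rewrite (mulrA (_ * (_ * _)) (s ^+ k)) z mul0r !mulr0.
rewrite -(subnKC cc') exprD (mulrA (u' ^+ c)) uXK mul1r sXuXsX//.
by rewrite -eqn_mod_dvd// eq_sym.
Qed.

Lemma cyl_sub c c' k k' : (k <= k')%N -> (c = c' %[mod 2 ^ k])%N ->
  cyl c k * cyl c' k' = cyl c' k'.
Proof.
move=> kk' /cyl_mod->; rewrite !cylE !mulrA -(mulrA _ (u' ^+ c') (u ^+ c')) uXK mulr1.
rewrite -{1}(subnKC kk') exprD !mulrA -(mulrA _ (s' ^+ k) (s ^+ k)) sXK mulr1.
by rewrite -(mulrA (u ^+ c')) -exprD subnKC.
Qed.

Lemma cyl_disj c c' k k' : (k <= k')%N -> (c != c' %[mod 2 ^ k])%N ->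
  cyl c k * cyl c' k' = 0.
Proof.
by move=> kk' ncc'; rewrite -(cyl_sub kk' (erefl (c' %% 2 ^ k)%N)) mulrA cyl_orth// mul0r.
Qed.

Lemma cylC c c' k k' : cyl c k * cyl c' k' = cyl c' k' * cyl c k.
Proof.
wlog kk' : c c' k k' / (k <= k')%N => [W|].
  by have [/W//|/ltnW/W->] := leqP k k'.
rewrite -[RHS]starK starM !star_cyl.
have [cc'|ncc'] := eqVneq (c %% 2 ^ k)%N (c' %% 2 ^ k)%N.
  by rewrite (cyl_sub kk' cc') star_cyl.
by rewrite (cyl_disj kk' ncc') star0.
Qed.

Lemma nrm_cyl c k : nrm (cyl c k) = 1.
Proof.
have v1 : star (u ^+ c * s ^+ k) * (u ^+ c * s ^+ k) = 1.
  by rewrite starM !starX mulrA -(mulrA _ (u' ^+ c) (u ^+ c)) uXK mulr1 sXK.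
have -> : cyl c k = u ^+ c * s ^+ k * star (u ^+ c * s ^+ k).
  by rewrite cylE starM !starX !mulrA.
by rewrite -{1}(starK (u ^+ c * _)) nrm_sqr nrm_star nrm_isometry ?expr1n.
Qed.

(** On residue classes [u] acts as [c -> c + 1] and [s] as [c -> 2 c]; this and the next three
    lemmas record it for powers and adjoints. *)
Lemma uX_cyl n c k : u ^+ n * cyl c k = cyl (c + n) k * u ^+ n.
Proof.
rewrite !cylE addnC exprD [(n + c)%N]addnC [u' ^+ (c + n)]exprD.
by rewrite !mulrA -(mulrA _ (u' ^+ n) (u ^+ n)) uXK mulr1.
Qed.

Lemma sX_cyl i c k : s ^+ i * cyl c k = cyl (2 ^ i * c) (k + i) * s ^+ i.
Proof.
rewrite !cylE !mulrA sXuX -!mulrA -sXuX' !mulrA.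
rewrite -(mulrA _ (s ^+ i) (s ^+ k)) -exprD addnC.
by rewrite [s' ^+ (k + i)]exprD !mulrA -(mulrA _ (s' ^+ i) (s ^+ i)) sXK mulr1.
Qed.

Lemma sX'_cyl j c k : s' ^+ j * cyl (2 ^ j * c) (k + j) = cyl c k * s' ^+ j.
Proof.
by rewrite -[LHS]starK starM star_cyl starX starK -sX_cyl starM star_cyl starX.
Qed.

Lemma uX'_cyl n c k : u' ^+ n * cyl (c + n) k = cyl c k * u' ^+ n.
Proof.
by rewrite -[LHS]starK starM star_cyl starX starK -uX_cyl starM star_cyl starX.
Qed.

Definition diag_comm x := forall c k, x * cyl c k = cyl c k * x.

Lemma diag_comm_star x : diag_comm x -> diag_comm (star x).
Proof. by move=> xc c k; rewrite -(star_cyl c k) -!starM xc. Qed.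

Lemma diag_commM x y : diag_comm x -> diag_comm y -> diag_comm (x * y).
Proof. by move=> xc yc c k; rewrite -mulrA yc mulrA xc mulrA. Qed.

Lemma diag_commB x y : diag_comm x -> diag_comm y -> diag_comm (x - y).
Proof. by move=> xc yc c k; rewrite mulrBl mulrBr xc yc. Qed.

(** Since [x] commutes with the two halves of a cylinder, it splits there into orthogonal pieces;
    [nrm_orth] then descends level by level to [cyl 0 0 = 1]. *)
Lemma nrm_le_cyl x k t : diag_comm x ->
  (forall c, nrm (x * cyl c k) <= t) -> nrm x <= t.
Proof.
move=> xc; elim: k => [|k IH] xt.
  by have := xt 0%N; rewrite cyl0 mulr1.
apply: IH => c; rewrite cyl_split mulrDr.
have ne : (c != c + 2 ^ k %[mod 2 ^ k.+1])%N.
  rewrite -{1}[c]addn0 eqn_modDl mod0n modn_small ?expnS ?ltn_Pmull ?expn_gt0//.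
  by rewrite eq_sym -lt0n expn_gt0.
apply: nrm_orth => //; rewrite starM star_cyl.
  rewrite -(diag_comm_star xc) -mulrA (mulrA (cyl _ _)) -xc -(mulrA x).
  by rewrite cyl_orth// !mulr0.
by rewrite !mulrA -(mulrA x) cyl_orth// mulr0 mul0r.
Qed.

End Relations.

(** * Density of the monomials and their compressions to cylinders *)

Section Monomials.
Variables (R : realType) (A : cstarType R) (s u : A).
Hypothesis rel : Q2_relations s u.
Implicit Types (a b c d e i j k m n : nat) (x y : A).

Local Notation s' := (star s).
Local Notation u' := (star u).
Local Notation cyl := (cyl s u).

(** In the 2-adic picture this is the map [x -> a + 2^i (x - b) / 2^j] on the class of [b] modulo
    [2^j]. *)
Definition mono a i j b : A := locked (u ^+ a * s ^+ i * s' ^+ j * u' ^+ b).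

Lemma monoE a i j b : mono a i j b = u ^+ a * s ^+ i * s' ^+ j * u' ^+ b.
Proof. by rewrite /mono -lock. Qed.

Lemma star_mono a i j b : star (mono a i j b) = mono b j i a.
Proof. by rewrite !monoE !starM !starX !starK !mulrA. Qed.

Lemma u_mono a i j b : u * mono a i j b = mono a.+1 i j b.
Proof. by rewrite !monoE exprS !mulrA. Qed.

Lemma s_mono a i j b : s * mono a i j b = mono (2 * a) i.+1 j b.
Proof.
by rewrite !monoE !mulrA -(expr1 s) (sXuX rel) expn1 expr1 exprS !mulrA.
Qed.

(** Exponents are natural, so for [a = 0] one writes [u' = u^(2^i - 1) u'^(2^i)]; the second factor
    crosses [s^i] as [u'] and then [s'^j] as [u'^(2^j)]. *)
Lemma u'_mono a i j b : u' * mono a i j b =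
  if a is d.+1 then mono d i j b else mono (2 ^ i).-1 i j (2 ^ j + b).
Proof.
case: a => [|d]; last by rewrite !monoE exprS !mulrA (uu1 rel) mul1r.
have i0 : (0 < 2 ^ i)%N by rewrite expn_gt0.
have e : u' = u ^+ (2 ^ i).-1 * u' ^+ (2 ^ i).
  by rewrite -{2}(prednK i0) exprSr mulrA (uXKr rel) mul1r.
have := sXuX' rel i 1; have := uX'sX' rel j 1; rewrite !expr1 !muln1 => e2 e1.
rewrite !monoE expr0 mul1r {1}e !mulrA -(mulrA _ (u' ^+ (2 ^ i))) -e1.
by rewrite -!mulrA (mulrA u') e2 exprD !mulrA.
Qed.

(** For [i = 0] an odd exponent is rounded up, [u^a = u^(a + 1) u'], and the spare [u'] crosses
    [s'^j]; for [i > 0] an odd exponent gives 0. *)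
Lemma s'_mono a i j b : s' * mono a i j b =
  if i is m.+1 then (if odd a then 0 else mono a./2 m j b) else
  if odd a then mono a./2.+1 0 j.+1 (2 ^ j + b) else mono a./2 0 j.+1 b.
Proof.
have aE := odd_double_half a; rewrite -mul2n in aE.
case: i => [|m]; rewrite !monoE -[in LHS]aE.
  rewrite !expr0 !mulr1; case: (odd a) => /=.
    have := uX'sX' rel j 1; rewrite !expr1 !muln1 => e2.
    have -> : u ^+ (1 + 2 * a./2) = u ^+ (2 * a./2.+1) * u'.
      by rewrite mulnS !addSn add0n [in RHS]exprSr -mulrA (uu1r rel) mulr1.
    rewrite !mulrA (uXs' rel) -!mulrA (mulrA u') e2 exprD [s' ^+ j.+1]exprS.
    by rewrite !mulrA.
  by rewrite add0n !mulrA (uXs' rel) exprS !mulrA.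
rewrite [s ^+ m.+1]exprS !mulrA; case: (odd a) => /=.
  by rewrite add1n (sus_odd rel) !mul0r.
by rewrite add0n (sus_even rel).
Qed.

Definition closed_linear (P : set A) :=
  [/\ P 0, forall (a : R[i]) x y, P x -> P y -> P (a *: x + y)
    & forall x, (forall e : R, 0 < e -> exists2 y, P y & nrm (x - y) < e) -> P x].

Hypothesis gen : cstar_generated [set 1; s; u] = setT.

(** [C] is the closed span of the monomials. The elements which, with their adjoints, preserve [C]
    by left multiplication form a C*-subalgebra containing [s] and [u], hence everything; apply them
    to [1] in [C]. *)
Lemma mono_ind (P : set A) : closed_linear P ->
  (forall a i j b, P (mono a i j b)) -> forall x, P x.
Proof.
pose C : set A := [set x | forall P : set A, closed_linear P ->
  (forall a i j b, P (mono a i j b)) -> P x].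
suff CT x : C x by move=> PP Pm x; exact: CT.
have Cm a i j b : C (mono a i j b) by move=> ? _; exact.
have Clin : closed_linear C.
  split=> [Q [] //|a y z Cy Cz Q QQ Qm|y Cy Q QQ Qm].
    by case: (QQ) => _ Ql _; apply: Ql; [exact: Cy|exact: Cz].
  by case: (QQ) => _ _; apply=> e /Cy[z Cz yz]; exists z => //; exact: Cz.
have nrm_lt (y z w : A) (e : R) : 0 < e ->
    nrm (z - w) < e / (nrm y + 1) -> nrm (y * z - y * w) < e.
  move=> e0; have y1 : 0 < nrm y + 1 by rewrite ltr_wpDl ?nrm_ge0.
  rewrite ltr_pdivlMr// -mulrBr; apply: le_lt_trans.
  by rewrite (le_trans (nrmM _ _))// mulrC ler_wpM2l ?nrm_ge0// lerDl.
have e_pos (y : A) (e : R) : 0 < e -> 0 < e / (nrm y + 1).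
  by move=> e0; rewrite divr_gt0// ltr_wpDl ?nrm_ge0.
have Cmul y : (forall a i j b, C (y * mono a i j b)) -> forall z, C z -> C (y * z).
  move=> Cym z Cz; apply: (Cz [set z | C (y * z)]) => //=.
  case: Clin => C0 Cl Cc; split => /=.
  - by rewrite mulr0.
  - by move=> a v w Cv Cw; rewrite mulrDr -scalerAr; exact: Cl.
  - move=> v Cv; apply: Cc => e e0; have [w Cw vw] := Cv _ (e_pos y e e0).
    by exists (y * w) => //; exact: nrm_lt.
case: (Clin) => C0 Cl Cc.
pose L : set A := [set y | forall z, C z -> C (y * z)].
have LL : closed_linear L.
  split => /= [z _|a v w Lv Lw z Cz|y Ly z Cz]; first by rewrite mul0r.
    by rewrite mulrDl -scalerAl; apply: Cl; [exact: Lv|exact: Lw].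
  apply: Cc => e e0; have [w Lw yw] := Ly _ (e_pos z e e0).
  exists (w * z); first exact: Lw.
  rewrite -mulrBl (le_lt_trans (nrmM _ _))//.
  have z1 : 0 < nrm z + 1 by rewrite ltr_wpDl ?nrm_ge0.
  move: yw; rewrite ltr_pdivlMr//; apply: le_lt_trans.
  by rewrite ler_wpM2l ?nrm_ge0// lerDl.
case: LL => L0 Ll Lc.
pose B : set A := [set y | L y /\ L (star y)].
have sB : cstar_subalgebra B.
  split => /=.
  - by split; rewrite ?star0.
  - move=> a y z [Ly Ly'] [Lz Lz']; split; first exact: Ll.
    by rewrite starD starZ; exact: Ll.
  - move=> y z [Ly Ly'] [Lz Lz']; split=> w Cw; rewrite ?starM -mulrA.
      by apply: Ly; exact: Lz.
    by apply: Lz'; exact: Ly'.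
  - by move=> y [Ly Ly']; split; rewrite ?starK.
  - apply: closedP => y By; split; apply: Lc => e /By[z [Lz Lz'] yz].
      by exists z.
    by exists (star z) => //; rewrite -starB nrm_star.
have sub : [set 1; s; u] `<=` B.
  move=> y [[->|->]|->]; split.
  - by move=> z; rewrite mul1r.
  - by move=> z; rewrite star1 mul1r.
  - by apply: Cmul => a i j b; rewrite s_mono.
  - by apply: Cmul => a i j b; rewrite s'_mono; case: i => [|i]; case: ifP.
  - by apply: Cmul => a i j b; rewrite u_mono.
  - by apply: Cmul => a i j b; rewrite u'_mono; case: a.
have : cstar_generated [set 1; s; u] x by rewrite gen.
move=> /(_ B (conj sB sub))[Lx _].
have C1 : C 1 by have := Cm 0%N 0%N 0%N 0%N; rewrite monoE !expr0 !mulr1.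
by have := Lx _ C1; rewrite mulr1.
Qed.

(** For [a = b] the monomial is a cylinder projection. Otherwise it translates by [a - b], which is
    nonzero modulo [2^k] for large [k], so the compression vanishes. *)
Lemma mono_diag a i b : exists k0, forall k, (k0 <= k)%N -> forall c,
  exists l : R[i], cyl c k * mono a i i b * cyl c k = l *: cyl c k.
Proof.
have [->|ab] := eqVneq a b.
  exists i => k ik c; rewrite monoE -cylE.
  have [bc|bc] := eqVneq (b %% 2 ^ i)%N (c %% 2 ^ i)%N.
    by exists 1; rewrite -mulrA (cyl_sub rel ik bc) (cyl_id rel) scale1r.
  by exists 0; rewrite -mulrA (cyl_disj rel ik bc) mulr0 scale0r.
exists (a + b)%N => k abk c; exists 0; rewrite scale0r.
have pow : (a + b < 2 ^ k)%N by exact: leq_trans (ltn_expl _ _) (leq_pexp2l _ abk).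
(* Adding a multiple of [2^k] keeps [c - a] and [c - b] natural without changing their classes. *)
have le m : (m <= a + b)%N -> (m <= c + 2 ^ k * m)%N.
  by move=> _; rewrite (leq_trans _ (leq_addl _ _))// leq_pmull// expn_gt0.
have ea : cyl c k * u ^+ a = u ^+ a * cyl (c + 2 ^ k * a - a) k.
  by rewrite (uX_cyl rel) subnK ?le ?leq_addr// (cyl_period rel).
have eb : u' ^+ b * cyl c k = cyl (c + 2 ^ k * b - b) k * u' ^+ b.
  by rewrite -(uX'_cyl rel) subnK ?le ?leq_addl// (cyl_period rel).
have mE : mono a i i b = u ^+ a * cyl 0 i * u' ^+ b.
  by rewrite monoE cylE !expr0 mul1r mulr1 !mulrA.
rewrite mE !mulrA ea -mulrA eb !mulrA -(mulrA _ _ (cyl 0 i)) (cylC rel _ 0) !mulrA.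
rewrite -(mulrA _ (cyl _ _) (cyl (c + 2 ^ k * b - b) k)) (cyl_orth rel) ?mulr0 ?mul0r//.
apply: contra ab => /eqP e.
have : (c + 2 ^ k * a - a + (a + b) = c + 2 ^ k * b - b + (a + b) %[mod 2 ^ k])%N.
  by apply/eqP; rewrite eqn_modDr e.
rewrite addnA subnK ?le ?leq_addr// (addnC a b) addnA subnK ?le ?leq_addl//.
move/eqP; rewrite -!addnA eqn_modDl !(mulnC (2 ^ k)%N) !modnMDl.
by rewrite !modn_small ?(leq_ltn_trans _ pow) ?leq_addr ?leq_addl// eq_sym.
Qed.

(** Up to adjoints [j < i], and the map contracts 2-adically: both halves of a small class have
    their images in one class modulo [2^K], so at least one half misses its image. *)
Lemma mono_offdiag a i j b c k : i != j -> exists c' k',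
  [/\ (k <= k')%N, (c' = c %[mod 2 ^ k])%N
    & cyl c' k' * mono a i j b * cyl c' k' = 0].
Proof.
wlog ji : a i j b / (j < i)%N => [W ij|_].
  have [ji|ij'] := ltnP j i; first exact: W.
  have ij2 : (i < j)%N by rewrite ltn_neqAle ij.
  have [|c' [k' [kk' cc' z]]] := W b j i a ij2; first by rewrite eq_sym.
  exists c', k'; split=> //; apply: (can_inj (@starK R A)).
  by rewrite !starM !star_cyl star_mono mulrA z star0.
pose k1 := maxn k j; pose K := k1.+1.
have kk1 : (k <= k1)%N by rewrite leq_maxl.
have jk1 : (j <= k1)%N by rewrite leq_maxr.
have jK : (j <= K)%N by rewrite ltnW.
(* [cc 0] and [cc 1] are the halves of the class of [c] modulo [2^k1]; [e t] below represents
   [cc t - b]. *)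
pose cc t := (c + 2 ^ k1 * t)%N.
have ext t : (k <= K)%N /\ (cc t = c %[mod 2 ^ k])%N.
  split; first exact: leqW.
  by rewrite /cc -(subnKC kk1) expnD -mulnA addnC mulnC modnMDl.
pose e t := (cc t + 2 ^ K * b - b)%N.
have be t : (b <= cc t + 2 ^ K * b)%N.
  by rewrite (leq_trans _ (leq_addl _ _))// leq_pmull// expn_gt0.
have eb t : u' ^+ b * cyl (cc t) K = cyl (e t) K * u' ^+ b.
  by rewrite -(uX'_cyl rel) subnK// (cyl_period rel).
have e1 : (e 1 = e 0 + 2 ^ k1)%N.
  by rewrite /e addnBAC// /cc muln1 muln0 addn0 addnAC.
have [dvd|ndvd] := boolP (2 ^ j %| e 0)%N; last first.
  exists (cc 0), K; case: (ext 0%N) => h1 h2; split=> //.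
  rewrite monoE -!mulrA eb (mulrA (s' ^+ j)).
  have -> : s' ^+ j * cyl (e 0) K = 0.
    have -> : s' ^+ j = s' ^+ j * cyl 0 j.
      by rewrite cylE !expr0 mul1r mulr1 mulrA (sXK rel) mul1r.
    by rewrite -mulrA (cyl_disj rel)// ?mulr0// mod0n eq_sym.
  by rewrite mul0r !mulr0.
have [f0 f0E] := dvdnP dvd; rewrite mulnC in f0E.
pose f t := (f0 + 2 ^ (k1 - j) * t)%N.
have fE t : (t < 2)%N -> e t = (2 ^ j * f t)%N.
  case: t => [|[|]]// _; first by rewrite f0E /f muln0 addn0.
  by rewrite e1 f0E /f muln1 mulnDr -expnD subnKC.
have eq t : (t < 2)%N -> cyl (cc t) K * mono a i j b * cyl (cc t) K =
    cyl (cc t) K * cyl (2 ^ i * f t + a) (K - j + i) * mono a i j b.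
  move=> t2; rewrite !monoE -!mulrA eb fE// -{2}(subnK jK) (mulrA (s' ^+ j)).
  rewrite (sX'_cyl rel) !mulrA -(mulrA _ (s ^+ i) (cyl _ _)) (sX_cyl rel) !mulrA.
  by rewrite -(mulrA _ (u ^+ a) (cyl _ _)) (uX_cyl rel) !mulrA.
have KK : (K <= K - j + i)%N by rewrite -{1}(subnK jK) leq_add2l ltnW.
have [c0|c0] := eqVneq (cc 0 %% 2 ^ K)%N ((2 ^ i * f 0 + a) %% 2 ^ K)%N; last first.
  exists (cc 0), K; case: (ext 0%N) => h1 h2; split=> //.
  by rewrite eq// (cyl_disj rel KK c0) mul0r.
exists (cc 1), K; case: (ext 1%N) => h1 h2; split=> //.
rewrite eq// (cyl_disj rel KK) ?mul0r//; apply/negP => /eqP c1.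
(* The images of the halves differ by [2^(i + k1 - j)], a multiple of [2^K] because [j < i]. *)
have f1 : (2 ^ i * f 1 + a = 2 ^ i * f 0 + a %[mod 2 ^ K])%N.
  rewrite /f muln1 muln0 addn0 mulnDr -expnD.
  have -> : (i + (k1 - j) = (i - j.+1) + K)%N.
    by rewrite -{1}(subnK ji) -addnA addSn subnKC.
  by rewrite -addnA addnCA expnD modnMDl.
have := c1; rewrite f1 -c0 /cc muln1 muln0 addn0 => /eqP.
rewrite -{2}[c]addn0 eqn_modDl mod0n modn_small ?expnS ?ltn_Pmull ?expn_gt0//.
by rewrite -leqn0 leqNgt expn_gt0.
Qed.

End Monomials.

(** * Gauge averages and Fejer means *)

(** The order of a [2^r]-th root of [-1] divides [2^(r+1)] but not [2^r]. *)
Lemma pow2_prim_root (C : numClosedFieldType) (r : nat) :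
  exists w : C, (2 ^ r.+1).-primitive_root w.
Proof.
pose w : C := (2 ^ r)%N.-root (-1).
have wr : w ^+ (2 ^ r) = -1 by rewrite rootCK// expn_gt0.
have w1 : w ^+ (2 ^ r.+1) = 1 by rewrite expnS mulnC exprM wr sqrrN expr1n.
have [|m prim] := prim_order_exists _ w1; first by rewrite expn_gt0.
move=> /(dvdn_pfactor _ _ (isT : prime 2))[k kr mk]; exists w.
move: kr; rewrite leq_eqVlt => /orP[/eqP kr|kr]; first by rewrite -kr -mk.
exfalso; have : w ^+ (2 ^ r) == 1.
  by rewrite -(prim_order_dvd prim) mk dvdn_exp2l.
by rewrite wr -subr_eq0 -opprD oppr_eq0 -mulr2n pnatr_eq0.
Qed.

Lemma conjC_norm1 (C : numClosedFieldType) (z : C) : `|z| = 1 -> (z^*)%R = z^-1.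
Proof. by move=> z1; rewrite invC_norm z1 expr1n invr1 mul1r. Qed.

Lemma norm1_exprz (C : numFieldType) (z : C) (m : int) : `|z| = 1 -> `|z ^ m| = 1.
Proof.
move=> z1; case: m => n; first by rewrite -exprnP normrX z1 expr1n.
by rewrite NegzE -exprnN normfV normrX z1 expr1n invr1.
Qed.

Section RootSum.
Variables (C : numClosedFieldType) (N : nat) (w : C).
Hypothesis prim : N.-primitive_root w.

Lemma prim_norm1 : `|w| = 1.
Proof.
have N0 := prim_order_gt0 prim; apply/eqP.
by rewrite -(@pexpr_eq1 _ _ N) ?normr_ge0// -normrX prim_expr_order// normr1.
Qed.

Lemma sum_root (m : int) : (absz m < N)%N ->
  \sum_(j < N) (w ^+ j) ^ m = (if m == 0 then N%:R else 0).
Proof.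
move=> mN; under eq_bigr => j _ do rewrite exprnP exprzAC -exprnP.
have [->|m0] := eqVneq m 0.
  by rewrite expr0z; under eq_bigr do rewrite expr1n; rewrite sumr_const card_ord.
have q1 : w ^ m - 1 != 0.
  rewrite subr_eq0; have m_gt0 : (0 < absz m)%N by rewrite absz_gt0.
  have ndvd : w ^+ absz m != 1.
    by rewrite -(prim_order_dvd prim) gtnNdvd.
  case: m {mN m_gt0 m0} ndvd => n //=; rewrite NegzE -exprnN invr_eq1//.
apply: (mulfI q1); rewrite mulr0 -subrX1 exprnP exprzAC -exprnP.
by rewrite prim_expr_order// exp1rz subrr.
Qed.

End RootSum.

(** * Properties of all roots of unity of large order *)

Section Eventually.
Variable R : realType.

(** Averages over [N]-th roots of unity replace integrals over the circle; [ev] is the passage to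
    large [N], whatever the primitive root. *)
Definition ev (Q : nat -> R[i] -> Prop) := exists N0 : nat, forall N w,
  (N0 <= N)%N -> N.-primitive_root w -> Q N w.

Lemma ev_and Q1 Q2 (Q : nat -> R[i] -> Prop) : ev Q1 -> ev Q2 ->
  (forall N w, N.-primitive_root w -> Q1 N w -> Q2 N w -> Q N w) -> ev Q.
Proof.
move=> [N1 h1] [N2 h2] h; exists (maxn N1 N2) => N w.
by rewrite geq_max => /andP[n1 n2] p; apply: h => //; [exact: h1|exact: h2].
Qed.

Lemma ev_sub Q1 (Q : nat -> R[i] -> Prop) : ev Q1 ->
  (forall N w, N.-primitive_root w -> Q1 N w -> Q N w) -> ev Q.
Proof. by move=> [N1 h1] h; exists N1 => N w n p; apply: h => //; exact: h1. Qed.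

Lemma ev_ge n : ev (fun N _ => (n <= N)%N).
Proof. by exists n. Qed.

Lemma ev_lt_forall n (Q : nat -> nat -> R[i] -> Prop) :
  (forall i, (i < n)%N -> ev (Q i)) ->
  ev (fun N w => forall i, (i < n)%N -> Q i N w).
Proof.
elim: n => [|n IH] h; first by exists 0%N.
apply: (ev_and (IH _) (h n _)) => // [i i_n|N w _ h1 h2 i].
  by apply: h; exact: ltnW.
by rewrite ltnS leq_eqVlt => /orP[/eqP->|/h1].
Qed.

Lemma ev_ex Q : ev Q -> exists N w, N.-primitive_root w /\ Q N w.
Proof.
move=> [N0 h]; have [w prim] := @pow2_prim_root R[i] N0.
exists (2 ^ N0.+1)%N, w; split=> //; apply: h => //.
by rewrite (leq_trans _ (ltnW (ltn_expl _ _))).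
Qed.

End Eventually.

Section Gauge.
Variables (R : realType) (A : cstarType R) (s u : A).
Implicit Types (x y : A) (z : R[i]).

Local Notation cyl := (cyl s u).
Local Notation mono := (mono s u).

Variable g : R[i] -> A -> A.
Hypothesis gP : forall z, `|z| = 1 ->
  [/\ unital_star_hom (g z), g z s = z *: s & g z u = u].

Lemma gauge_hom z : `|z| = 1 -> unital_star_hom (g z).
Proof. by case/gP. Qed.

Lemma gauge_mono z a i j b : `|z| = 1 ->
  g z (mono a i j b) = z ^ (i%:Z - j%:Z) *: mono a i j b.
Proof.
move=> z1; have [gh gs gu] := gP z1.
have z0 : z != 0 by rewrite -normr_eq0 z1 oner_eq0.
rewrite !monoE !(homM gh) !(homX gh) !(hom_star gh) gs gu starZ conjC_norm1// !exprZn.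
rewrite -!(scalerAr, scalerAl) scalerA expfzDr//.
by rewrite -exprnP -exprnN -exprVn mulrC.
Qed.

Lemma gauge_cyl z c k : `|z| = 1 -> g z (cyl c k) = cyl c k.
Proof.
move=> z1; have -> : cyl c k = mono c k k c by rewrite monoE cylE.
by rewrite gauge_mono// subrr expr0z scale1r.
Qed.

Lemma gauge_diag_comm z x : `|z| = 1 -> diag_comm s u x -> diag_comm s u (g z x).
Proof.
by move=> z1 xc c k; rewrite -(gauge_cyl c k z1) -!(homM (gauge_hom z1)) xc.
Qed.

Section Average.
Variables (N : nat) (w : R[i]).

(** A discrete Fourier coefficient of [z -> g z x]: it extracts the part of degree [m] modulo
    [N]. *)
Definition avg (m : int) x : A :=
  N%:R^-1 *: \sum_(j < N) (w ^+ j) ^ (- m) *: g (w ^+ j) x.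

(** Exactly [M - |n|] pairs have difference [n], so degree [n] receives the Fejer weight
    [1 - |n| / M] when [|n| < M]. *)
Definition fejer (M : nat) x : A :=
  M%:R^-1 *: \sum_(a < M) \sum_(b < M) avg (a%:Z - b%:Z) x.

Hypothesis prim : N.-primitive_root w.

Let wj (j : nat) : `|w ^+ j| = 1.
Proof. by rewrite normrX (prim_norm1 prim) expr1n. Qed.

Let wj0 (j : nat) : w ^+ j != 0.
Proof. by rewrite -normr_eq0 wj oner_eq0. Qed.

Let N0 : (N%:R : R[i]) != 0.
Proof. by rewrite pnatr_eq0 -lt0n (prim_order_gt0 prim). Qed.

Lemma avgP m a x y : avg m (a *: x + y) = a *: avg m x + avg m y.
Proof.
rewrite /avg scalerA mulrC -scalerA -scalerDr; congr (_ *: _).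
rewrite scaler_sumr -big_split/=; apply: eq_bigr => j _.
by rewrite (homP (gauge_hom (wj j))) scalerDr !scalerA mulrC.
Qed.

Lemma avg0x m : avg m 0 = 0.
Proof. by have := avgP m (-1) 0 0; rewrite scaler0 add0r scaleN1r addNr. Qed.

Lemma avgB m x y : avg m (x - y) = avg m x - avg m y.
Proof. by rewrite addrC -scaleN1r avgP scaleN1r addrC. Qed.

Lemma fejerP M a x y : fejer M (a *: x + y) = a *: fejer M x + fejer M y.
Proof.
rewrite /fejer scalerA mulrC -scalerA -scalerDr; congr (_ *: _).
rewrite scaler_sumr -big_split/=; apply: eq_bigr => i _.
rewrite scaler_sumr -big_split/=; apply: eq_bigr => j _.
exact: avgP.
Qed.

Lemma fejer0x M : fejer M 0 = 0.
Proof. by have := fejerP M (-1) 0 0; rewrite scaler0 add0r scaleN1r addNr. Qed.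

Lemma fejerB M x y : fejer M (x - y) = fejer M x - fejer M y.
Proof. by rewrite addrC -scaleN1r fejerP scaleN1r addrC. Qed.

Let norm_gauge j x : `|g (w ^+ j) x| <= `|x|.
Proof. by rewrite !nrmE lecR (hom_nrm (gauge_hom (wj j))). Qed.

Lemma nrm_avg m x : nrm (avg m x) <= nrm x.
Proof.
rewrite -lecR -!nrmE /avg normrZ ger0_norm ?invr_ge0 ?ler0n//.
rewrite ler_pdivrMl ?ltr0n ?(prim_order_gt0 prim)// mulr_natl.
rewrite (le_trans (ler_norm_sum _ _ _))//.
rewrite (le_trans (ler_sum _ (G := fun=> `|x|) _))//; last first.
  by rewrite sumr_const card_ord.
move=> j _; rewrite normrZ [X in X * _](_ : _ = 1) ?mul1r//.
exact: norm1_exprz.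
Qed.

Lemma avg_mono (m : int) a i j b : (absz (i%:Z - j%:Z - m)%R < N)%N ->
  avg m (mono a i j b) = if i%:Z - j%:Z == m then mono a i j b else 0.
Proof.
move=> mN; rewrite /avg.
under eq_bigr => k _ do rewrite gauge_mono// scalerA -expfzDr// addrC.
rewrite -scaler_suml (sum_root prim mN) subr_eq0 scalerA.
by case: ifP => _; rewrite ?mulVf ?scale1r// mulr0 scale0r.
Qed.

Lemma avg_diag_comm m x : diag_comm s u x -> diag_comm s u (avg m x).
Proof.
move=> xc c k; rewrite /avg -scalerAl -scalerAr mulr_suml mulr_sumr.
congr (_ *: _); apply: eq_bigr => j _; rewrite -scalerAl -scalerAr.
by rewrite gauge_diag_comm.
Qed.

Lemma avg_fixed x : (forall z, `|z| = 1 -> g z x = x) -> avg 0 x = x.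
Proof.
move=> gx; rewrite /avg; under eq_bigr => j _ do rewrite oppr0 expr0z scale1r gx//.
by rewrite sumr_const card_ord -(scaler_nat N x) scalerA mulVf// scale1r.
Qed.

(* The coefficients of the Fejer mean are the nonnegative numbers
   |sum_(a < M) w^(-ja)|^2, whose sum over j is M * N. *)
Lemma nrm_fejer M x : (0 < M <= N)%N -> nrm (fejer M x) <= nrm x.
Proof.
move=> /andP[M0 MN].
pose K (j : nat) : R[i] := \sum_(a < M) \sum_(b < M) (w ^+ j) ^ (- (a%:Z - b%:Z)).
have K_ge0 j : 0 <= K j.
  have -> : K j = `|\sum_(b < M) (w ^+ j) ^ b%:Z| ^+ 2.
    rewrite normCK mulrC rmorph_sum mulr_suml; apply: eq_bigr => a _.
    rewrite mulr_sumr; apply: eq_bigr => b _.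
    rewrite opprB addrC expfzDr//; congr (_ * _).
    by rewrite -exprnP rmorphXn/= conjC_norm1// -exprnN -exprVn.
  by rewrite exprn_ge0.
have K_sum : \sum_(j < N) K j = M%:R * N%:R.
  rewrite exchange_big/=; transitivity (\sum_(a < M) (N%:R : R[i])).
    apply: eq_bigr => a _; rewrite exchange_big/= (bigD1 a)//=.
    rewrite (sum_root prim) ?subrr// ?(prim_order_gt0 prim)// eqxx.
    rewrite big1 ?addr0// => b ba; rewrite (sum_root prim).
      by rewrite oppr_eq0 subr_eq0 eqz_nat val_eqE eq_sym (negbTE ba).
    by have := ltn_ord a; have := ltn_ord b; lia.
  by rewrite sumr_const card_ord mulr_natl.
have -> : fejer M x = (M%:R * N%:R)^-1 *: \sum_(j < N) K j *: g (w ^+ j) x.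
  rewrite /fejer invfM -scalerA; congr (_ *: _).
  under eq_bigr => a _ do rewrite -scaler_sumr.
  rewrite -scaler_sumr; congr (_ *: _).
  under eq_bigr => a _ do rewrite exchange_big/=.
  rewrite exchange_big/=; apply: eq_bigr => j _.
  rewrite /K scaler_suml; apply: eq_bigr => a _.
  by rewrite scaler_suml.
have M0' : (M%:R : R[i]) != 0 by rewrite pnatr_eq0 -lt0n.
rewrite -lecR -!nrmE normrZ ger0_norm ?invr_ge0 ?mulr_ge0 ?ler0n//.
rewrite ler_pdivrMl ?mulr_gt0 ?ltr0n ?(prim_order_gt0 prim)// -K_sum mulr_suml.
rewrite (le_trans (ler_norm_sum _ _ _))// ler_sum// => j _.
by rewrite normrZ ger0_norm// ler_wpM2l.
Qed.

End Average.
End Gauge.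

Lemma sum_nat_shift (n M : nat) :
  (\sum_(a < M) \sum_(b < M) (n + b == a) = M - n)%N.
Proof.
rewrite exchange_big/= (eq_bigr (fun b : 'I_M => (b < M - n)%N : nat)) => [|b _].
  rewrite -big_mkcond/= (big_ord_narrow (leq_subr n M))/=.
  by rewrite sum1_card card_ord.
have [lt|ge] := ltnP (n + b) M.
  rewrite (bigD1 (Ordinal lt))//= eqxx big1 => [|a]; last first.
    by rewrite -val_eqE/= eq_sym => /negbTE->.
  by rewrite addn0 ltn_subRL lt.
rewrite big1 => [|a _]; first by rewrite ltn_subRL ltnNge ge.
by rewrite gtn_eqF// (leq_trans (ltn_ord a)).
Qed.

Lemma archi_le (R : realType) (K e : R) : 0 < e -> exists M : nat, K <= M%:R * e.
Proof.
move=> e0; exists (Num.bound `|K / e|); rewrite -ler_pdivrMr//.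
by rewrite (le_trans (ler_norm _))// ltW// archi_boundP.
Qed.

(** * Reduction to monomials and convergence of Fejer means *)

Section Approximation.
Variables (R : realType) (A : cstarType R).

(** Read [E e x] as a property of [x] up to error [e]: errors combine linearly, and moving [x] by a
    distance [d] costs at most [2 d]. *)
Lemma closed_linear_approx (E : R -> A -> Prop) :
  (forall e, 0 < e -> E e 0) ->
  (forall e e' x, e <= e' -> E e x -> E e' x) ->
  (forall a x y e1 e2, E e1 x -> E e2 y -> E (cabs a * e1 + e2) (a *: x + y)) ->
  (forall x y e, E e y -> E (e + 2 * nrm (x - y)) x) ->
  closed_linear [set x : A | forall e, 0 < e -> E e x].
Proof.
move=> E0 Ele El Ec; split=> [e|a x y Ex Ey e e0|x Ex e e0] /=; first exact: E0.
  have a1 : 0 < 2 * (cabs a + 1) by rewrite mulr_gt0// ltr_wpDl ?cabs_ge0.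
  apply: Ele (El a x y _ _ (Ex _ (divr_gt0 e0 a1)) (Ey (e / 2) _)); last by lra.
  rewrite -lerBrDr (_ : e - e / 2 = e / 2); last by lra.
  rewrite mulrA ler_pdivrMr// mulrA divfK ?pnatr_eq0//.
  by rewrite mulrC ler_pM2l// lerDl.
have [|y Ey xy] := Ex (e / 4); first by lra.
by apply: Ele (Ec x y (e / 2) (Ey _ _)); lra.
Qed.

End Approximation.

Section Localization.
Variables (R : realType) (A : cstarType R) (s u : A).
Hypothesis rel : Q2_relations s u.
Hypothesis gen : cstar_generated [set 1; s; u] = setT.
Implicit Types (x y : A) (z : R[i]).

Local Notation cyl := (cyl s u).
Local Notation mono := (mono s u).

Variable g : R[i] -> A -> A.
Hypothesis gP : forall z, `|z| = 1 ->
  [/\ unital_star_hom (g z), g z s = z *: s & g z u = u].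

Local Notation avg := (avg g).
Local Notation fejer := (fejer g).

Lemma approx_ind (E : R -> A -> Prop) :
  (forall e, 0 < e -> E e 0) ->
  (forall e e' x, e <= e' -> E e x -> E e' x) ->
  (forall a x y e1 e2, E e1 x -> E e2 y -> E (cabs a * e1 + e2) (a *: x + y)) ->
  (forall x y e, E e y -> E (e + 2 * nrm (x - y)) x) ->
  (forall a i j b e, 0 < e -> E e (mono a i j b)) ->
  forall x e, 0 < e -> E e x.
Proof.
move=> E0 Ele El Ec Em; apply: (mono_ind rel gen (closed_linear_approx E0 Ele El Ec)).
by move=> a i j b e; exact: Em.
Qed.

(** [N > 2 M] separates the degrees involved modulo [N], so the Fejer mean multiplies the monomial
    by [1 - |i - j| / M]. *)
Lemma fejer_mono N w M a i j b : N.-primitive_root w -> (0 < M)%N ->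
  (absz (i%:Z - j%:Z)%R <= M)%N -> (2 * M < N)%N ->
  nrm (fejer N w M (mono a i j b) - mono a i j b) <=
    (absz (i%:Z - j%:Z)%R)%:R / M%:R * nrm (mono a i j b).
Proof.
move=> prim M0 nM MN; set n := absz _ in nM *; set x := mono a i j b.
have M0' : (M%:R : R) != 0 by rewrite pnatr_eq0 -lt0n.
have M0c : (M%:R : R[i]) != 0 by rewrite pnatr_eq0 -lt0n.
have fE : fejer N w M x = ((M - n)%:R / M%:R) *: x.
  rewrite /fejer mulrC -scalerA; congr (_ *: _).
  transitivity (\sum_(c < M) \sum_(d < M) (i%:Z - j%:Z == c%:Z - d%:Z)%:R *: x).
    apply: eq_bigr => c _; apply: eq_bigr => d _.
    rewrite (avg_mono gP)//; first by case: eqP; rewrite ?scale1r ?scale0r.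
    by have := ltn_ord c; have := ltn_ord d; rewrite /n in nM; lia.
  under eq_bigr => c _ do rewrite -scaler_suml -natr_sum.
  rewrite -scaler_suml -natr_sum; congr (_%:R *: _).
  have [ij|ij] := leqP j i.
    rewrite -sum_nat_shift; apply: eq_bigr => c _; apply: eq_bigr => d _.
    by congr nat_of_bool; apply/eqP/eqP; rewrite /n; lia.
  rewrite exchange_big/= -sum_nat_shift; apply: eq_bigr => c _; apply: eq_bigr => d _.
  by congr nat_of_bool; apply/eqP/eqP; rewrite /n; lia.
rewrite fE -[X in _ - X]scale1r -scalerBl natrB// mulrBl mulfV// addrAC subrr add0r.
rewrite nrmZ ler_wpM2r ?nrm_ge0//.
rewrite le_eqVlt; apply/orP; left; apply/eqP; apply: complexI.
by rewrite -cabsE normrN ger0_norm ?divr_ge0 ?ler0n// rmorphM/= fmorphV/= !rmorph_nat.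
Qed.

Lemma fejer_cvg x (e : R) : 0 < e ->
  exists2 M, (0 < M)%N & ev (fun N w => nrm (fejer N w M x - x) <= e).
Proof.
(* A linear combination needs one [M] for both terms, so the induction treats all [M > M0]. *)
suff /(_ x e) : forall x (e : R), 0 < e -> exists M0, forall M, (M0 < M)%N ->
    ev (fun N w => nrm (fejer N w M x - x) <= e).
  by move=> h /h[M0 /(_ M0.+1 (ltnSn _))]; exists M0.+1.
apply: approx_ind.
- move=> {}e e0; exists 0%N => M _; exists 0%N => N w _ prim.
  by rewrite (fejer0x gP)// subrr nrm0 ltW.
- move=> {}e e' {}x ee' [M0 h]; exists M0 => M /h; move/ev_sub; apply=> N w _.
  by move/le_trans; apply.
- move=> a {}x y e1 e2 [M1 h1] [M2 h2]; exists (maxn M1 M2) => M.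
  rewrite gtn_max => /andP[/h1 k1 /h2 k2]; apply: (ev_and k1 k2) => N w prim l1 l2.
  rewrite (fejerP gP)// opprD addrACA -scalerBr (le_trans (nrmD _ _))//.
  by rewrite lerD// nrmZ ler_wpM2l ?cabs_ge0.
- move=> {}x y {}e [M0 h]; exists M0 => M M0M.
  have M_gt0 : (0 < M)%N by exact: leq_ltn_trans M0M.
  apply: (ev_and (h M M0M) (ev_ge R M)) => N w prim l MN.
  have -> : fejer N w M x - x = fejer N w M (x - y) + (fejer N w M y - y) + (y - x).
    by rewrite (fejerB gP)// !addrA !subrK.
  rewrite (le_trans (nrmD _ _))// (nrmB y).
  rewrite (le_trans (lerD (nrmD _ _) (lexx _)))//.
  have : nrm (fejer N w M (x - y)) <= nrm (x - y).
    by rewrite (nrm_fejer gP)// M_gt0.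
  lra.
- move=> a i j b {}e e0.
  have [M1 h1] := archi_le ((absz (i%:Z - j%:Z)%R)%:R * nrm (mono a i j b)) e0.
  exists (maxn M1 (absz (i%:Z - j%:Z)%R)) => M; rewrite gtn_max => /andP[M1M nM].
  apply: (ev_sub (ev_ge R (2 * M).+1)) => N w prim MN.
  have M0 : (0 < M)%N by exact: leq_ltn_trans M1M.
  rewrite (le_trans (fejer_mono _ _ prim M0 (ltnW nM) MN))//.
  rewrite mulrAC ler_pdivrMr ?ltr0n// (le_trans h1)// mulrC.
  by rewrite ler_wpM2l ?(ltW e0)// ler_nat ltnW.
Qed.

End Localization.

(** * The commutant of the diagonal *)

Section LocalScalar.
Variables (R : realType) (A : cstarType R) (s u : A).
Hypothesis rel : Q2_relations s u.
Hypothesis gen : cstar_generated [set 1; s; u] = setT.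
Implicit Types (x y : A) (z : R[i]) (c k : nat).

Local Notation cyl := (cyl s u).
Local Notation mono := (mono s u).

Variable g : R[i] -> A -> A.
Hypothesis gP : forall z, `|z| = 1 ->
  [/\ unital_star_hom (g z), g z s = z *: s & g z u = u].

Local Notation avg := (avg g).
Local Notation fejer := (fejer g).

Definition corner c k x : A := locked (cyl c k * x * cyl c k).

Lemma cornerE c k x : corner c k x = cyl c k * x * cyl c k.
Proof. by rewrite /corner -lock. Qed.

Lemma cornerP c k a x y : corner c k (a *: x + y) = a *: corner c k x + corner c k y.
Proof. by rewrite !cornerE mulrDr mulrDl -scalerAr -scalerAl. Qed.

Lemma cornerD c k x y : corner c k (x + y) = corner c k x + corner c k y.
Proof. by rewrite -{1}(scale1r x) cornerP scale1r. Qed.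

Lemma cornerB c k x y : corner c k (x - y) = corner c k x - corner c k y.
Proof. by rewrite addrC -scaleN1r cornerP scaleN1r addrC. Qed.

Lemma corner0 c k : corner c k 0 = 0.
Proof. by rewrite cornerE mulr0 mul0r. Qed.

Lemma nrm_corner c k x : nrm (corner c k x) <= nrm x.
Proof.
rewrite cornerE -mulrA (le_trans (nrm_mull_le1 _ _)) ?(nrm_cyl rel)//.
by rewrite nrm_mulr_le1 ?(nrm_cyl rel).
Qed.

Lemma corner_comm c k x : diag_comm s u x -> corner c k x = x * cyl c k.
Proof. by move=> xc; rewrite cornerE -xc -mulrA (cyl_id rel). Qed.

Lemma corner_sub c k c' k' x : (k <= k')%N -> (c' = c %[mod 2 ^ k])%N ->
  corner c' k' x = corner c' k' (corner c k x).
Proof.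
move=> kk' cc'; rewrite !cornerE; have sub := cyl_sub rel kk' (esym cc').
by rewrite !mulrA (cylC rel c') sub -!mulrA sub.
Qed.

Lemma nrm_corner_sub c k c' k' x : (k <= k')%N -> (c' = c %[mod 2 ^ k])%N ->
  nrm (corner c' k' x) <= nrm (corner c k x).
Proof. by move=> kk' cc'; rewrite (corner_sub _ kk' cc') nrm_corner. Qed.

Definition homog (m : int) y := forall z, `|z| = 1 -> g z y = z ^ m *: y.

(** For large [N] the average of a monomial is 0 or the monomial itself, hence homogeneous; for
    general [x] finitely many roots give this only approximately. *)
Lemma homog_avg (m : int) x (e : R) : 0 < e ->
  ev (fun N w => exists2 y, homog m y & nrm (avg N w m x - y) <= e).
Proof.
move: x e; apply: (approx_ind rel gen).
- move=> e e0; exists 0%N => N w _ prim; exists 0.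
    by move=> z z1; rewrite (hom0 (gauge_hom gP z1)) scaler0.
  by rewrite (avg0x gP)// subrr nrm0 ltW.
- move=> e e' x ee' h; apply: (ev_sub h) => N w _ [y hy xy]; exists y => //.
  exact: le_trans ee'.
- move=> a x y e1 e2 h1 h2; apply: (ev_and h1 h2) => N w prim [x' hx xx'] [y' hy yy'].
  exists (a *: x' + y').
    by move=> z z1; rewrite (homP (gauge_hom gP z1)) hx// hy// scalerDr !scalerA mulrC.
  rewrite (avgP gP)// opprD addrACA -scalerBr (le_trans (nrmD _ _))//.
  by rewrite lerD// nrmZ ler_wpM2l ?cabs_ge0.
- move=> x y e h; apply: (ev_sub h) => N w prim [y' hy yy']; exists y' => //.
  have := nrm_tri (avg N w m y) (avg N w m x) y'; rewrite -(avgB gP)//.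
  have : nrm (avg N w m (x - y)) <= nrm (x - y) by exact: (nrm_avg gP).
  have := nrm_ge0 (x - y); lra.
- move=> a i j b e e0; apply: (ev_sub (ev_ge R (absz (i%:Z - j%:Z - m)%R).+1)).
  move=> N w prim nN; rewrite (avg_mono gP)//; case: ifP => [/eqP <-|_].
    exists (mono a i j b); last by rewrite subrr nrm0 ltW.
    by move=> z z1; rewrite (gauge_mono gP).
  exists 0; last by rewrite subrr nrm0 ltW.
  by move=> z z1; rewrite (hom0 (gauge_hom gP z1)) scaler0.
Qed.

(** Monomials of degree [m] have [i != j] and fall under [mono_offdiag]. For sums, the second
    subcylinder is chosen inside the first, which is why every starting cylinder is allowed. *)
Lemma avg_offdiag (m : int) x (e : R) : m != 0 -> 0 < e ->
  ev (fun N w => forall c k, exists c' k', [/\ (k <= k')%N,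
    (c' = c %[mod 2 ^ k])%N & nrm (corner c' k' (avg N w m x)) <= e]).
Proof.
move=> m0; move: x e; apply: (approx_ind rel gen).
- move=> e e0; exists 0%N => N w _ prim c k; exists c, k; split=> //.
  by rewrite (avg0x gP)// corner0 nrm0 ltW.
- move=> e e' x ee' h; apply: (ev_sub h) => N w _ {}h c k.
  have [c' [k' [kk' cc' l]]] := h c k; exists c', k'; split=> //.
  exact: le_trans ee'.
- move=> a x y e1 e2 h1 h2; apply: (ev_and h1 h2) => N w prim {}h1 {}h2 c k.
  have [c1 [k1 [kk1 cc1 l1]]] := h1 c k.
  have [c2 [k2 [kk2 cc2 l2]]] := h2 c1 k1.
  exists c2, k2; split; first exact: leq_trans kk2.
    by rewrite -cc1 -(modn_dvdm c2 (dvdn_exp2l 2 kk1)) cc2 modn_dvdm// dvdn_exp2l.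
  rewrite (avgP gP)// cornerP (le_trans (nrmD _ _))// lerD// nrmZ.
  rewrite ler_wpM2l ?cabs_ge0//; apply: le_trans l1.
  exact: nrm_corner_sub.
- move=> x y e h; apply: (ev_sub h) => N w prim {}h c k.
  have [c' [k' [kk' cc' l]]] := h c k; exists c', k'; split=> //.
  have := nrmD (corner c' k' (avg N w m (x - y))) (corner c' k' (avg N w m y)).
  rewrite -cornerD {1}(avgB gP)// subrK.
  have := nrm_corner c' k' (avg N w m (x - y)).
  have : nrm (avg N w m (x - y)) <= nrm (x - y) by exact: (nrm_avg gP).
  by have := nrm_ge0 (x - y); lra.
- move=> a i j b e e0; apply: (ev_sub (ev_ge R (absz (i%:Z - j%:Z - m)%R).+1)).
  move=> N w prim nN c k; rewrite (avg_mono gP)//; case: ifP => [/eqP mE|_].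
    have ij : i != j by apply: contra m0 => /eqP ij; rewrite -mE ij subrr.
    have [c' [k' [kk' cc' z]]] := mono_offdiag rel a b c k ij.
    by exists c', k'; split=> //; rewrite cornerE z nrm0 ltW.
  by exists c, k; split=> //; rewrite corner0 nrm0 ltW.
Qed.

(** Monomials of degree 0 fall under [mono_diag]; asking for all levels [k >= k0] gives sums a
    common level. *)
Lemma avg_local x (e : R) : 0 < e ->
  ev (fun N w => exists k0, forall k, (k0 <= k)%N -> forall c, exists l : R[i],
    nrm (corner c k (avg N w 0 x) - l *: cyl c k) <= e).
Proof.
move: x e; apply: (approx_ind rel gen).
- move=> e e0; exists 0%N => N w _ prim; exists 0%N => k _ c; exists 0.
  by rewrite (avg0x gP)// corner0 scale0r subrr nrm0 ltW.
- move=> e e' x ee' h; apply: (ev_sub h) => N w _ [k0 {}h]; exists k0 => k kk c.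
  have [l hl] := h k kk c; exists l; exact: le_trans ee'.
- move=> a x y e1 e2 h1 h2; apply: (ev_and h1 h2) => N w prim [k1 {}h1] [k2 {}h2].
  exists (maxn k1 k2) => k; rewrite geq_max => /andP[/h1{}h1 /h2{}h2] c.
  have [[l1 hl1] [l2 hl2]] := (h1 c, h2 c).
  exists (a * l1 + l2); rewrite (avgP gP)// cornerP scalerDl -scalerA.
  rewrite opprD addrACA -scalerBr (le_trans (nrmD _ _))//.
  by rewrite lerD// nrmZ ler_wpM2l ?cabs_ge0.
- move=> x y e h; apply: (ev_sub h) => N w prim [k0 {}h]; exists k0 => k kk c.
  have [l hl] := h k kk c; exists l.
  have := nrm_tri (corner c k (avg N w 0 y)) (corner c k (avg N w 0 x)) (l *: cyl c k).
  rewrite -cornerB -(avgB gP)//.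
  have := nrm_corner c k (avg N w 0 (x - y)).
  have : nrm (avg N w 0 (x - y)) <= nrm (x - y) by exact: (nrm_avg gP).
  by have := nrm_ge0 (x - y); lra.
- move=> a i j b e e0; apply: (ev_sub (ev_ge R (absz (i%:Z - j%:Z - 0)%R).+1)).
  move=> N w prim nN; rewrite (avg_mono gP)//; case: ifP => [/eqP mE|_].
    have ij : j = i by move: mE; clear; lia.
    have [k0 h] := mono_diag rel a i b; exists k0 => k kk c.
    have [l hl] := h k kk c; exists l; rewrite ij cornerE hl.
    by rewrite subrr nrm0 ltW.
  exists 0%N => k _ c; exists 0.
  by rewrite corner0 scale0r subrr nrm0 ltW.
Qed.

Lemma homog_sqr m y : homog m y -> forall z, `|z| = 1 -> g z (star y * y) = star y * y.
Proof.
move=> hy z z1; have gh := gauge_hom gP z1.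
rewrite (homM gh) (hom_star gh) hy// starZ -scalerAl -scalerAr scalerA.
by rewrite mulrC -normCK norm1_exprz// expr1n scale1r.
Qed.

(** [star y * y] is gauge invariant, so it is its own average of degree 0. *)
Lemma homog_local m y (e : R) : homog m y -> 0 < e ->
  exists k, forall c, exists l : R[i],
    nrm (corner c k (star y * y) - l *: cyl c k) <= e.
Proof.
move=> hy /(avg_local (star y * y))/ev_ex[N [w [prim [k /(_ k (leqnn k)) h]]]].
exists k => c; have [l hl] := h c; exists l.
by rewrite (avg_fixed prim (homog_sqr hy)) in hl.
Qed.

(* With v the degree-m component, v^* v is locally almost scalar, so it is small
   on a small enough cylinder as soon as v is small on a subcylinder. *)
Lemma avg_vanish (m : int) x (d : R) : m != 0 -> diag_comm s u x -> 0 < d ->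
  ev (fun N w => nrm (avg N w m x) <= d).
Proof.
move=> m0 xc d0; set X := nrm x; have X0 : 0 <= X := nrm_ge0 x.
(* [5 * X + 4] is the sum of [3 * X + 2], from the bound on [l], and [2 * X + 2], from the distance
   of [star v * v] to [l] on a cylinder. *)
pose e := Num.min 1 (d ^+ 2 / (5 * X + 4)).
have D0 : 0 < 5 * X + 4 by lra.
have e0 : 0 < e by rewrite lt_min ltr01 divr_gt0// exprn_gt0.
have e1 : e <= 1 by rewrite ge_min lexx.
have eD : e * (5 * X + 4) <= d ^+ 2 by rewrite -ler_pdivlMr// ge_min lexx orbT.
apply: (ev_and (avg_offdiag x m0 e0) (homog_avg m x e0)) => N w prim off [y hy vy].
set v := avg N w m x in off vy *.
have vX : nrm v <= X by exact: (nrm_avg gP).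
have vc : diag_comm s u v by exact: (avg_diag_comm gP).
have fc : diag_comm s u (star v * v).
  by apply: diag_commM => //; exact: diag_comm_star.
have yX : nrm y <= X + e.
  by have := nrm_tri v y 0; rewrite !subr0 (nrmB y); lra.
have [k loc] := homog_local hy e0.
have fy : nrm (star v * v - star y * y) <= e * (2 * X + 1).
  have -> : star v * v - star y * y = star v * (v - y) + star (v - y) * y.
    by rewrite starB mulrBr mulrBl addrA subrK.
  rewrite (le_trans (nrmD _ _))//.
  have := nrmM (star v) (v - y); have := nrmM (star (v - y)) y.
  rewrite !nrm_star; have := nrm_ge0 v; have := nrm_ge0 y; have := nrm_ge0 (v - y).
  nra.
rewrite -(ler_pXn2r (n := 2)) ?nnegrE ?nrm_ge0 ?(ltW d0)// -nrm_sqr.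
apply: le_trans eD; apply: (nrm_le_cyl rel (k := k)) => // c.
have [l hl] := loc c; have [c' [k' [kk' cc' small]]] := off c k.
have fl : nrm (star v * v * cyl c k - l *: cyl c k) <= e * (2 * X + 2).
  rewrite -(corner_comm _ _ fc).
  have := nrm_tri (corner c k (star y * y)) (corner c k (star v * v)) (l *: cyl c k).
  by rewrite -cornerB; have := nrm_corner c k (star v * v - star y * y); lra.
have sub : cyl c k * cyl c' k' = cyl c' k' by exact: (cyl_sub rel).
(* On the subcylinder [star v * v] has norm at most [X * e], which forces the scalar [l] to be
   small. *)
have lc : cabs l <= e * (3 * X + 2).
  have := nrm_mulr_le1 (star v * v * cyl c k - l *: cyl c k) (y := cyl c' k').
  rewrite (nrm_cyl rel) lexx => /(_ isT); rewrite mulrBl -(mulrA _ (cyl c k)) -scalerAl sub.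
  have := nrm_tri (star v * v * cyl c' k') (l *: cyl c' k') 0.
  rewrite !subr0 nrmZ (nrm_cyl rel) mulr1 (nrmB (l *: _)).
  have := nrmM (star v) (v * cyl c' k'); rewrite nrm_star mulrA.
  rewrite -(corner_comm _ _ vc); have := nrm_ge0 v.
  have := nrm_ge0 (corner c' k' v).
  nra.
have := nrm_tri (l *: cyl c k) (star v * v * cyl c k) 0.
rewrite !subr0 nrmZ (nrm_cyl rel) mulr1; lra.
Qed.

(** Three errors of [e / 3]: from [x] to its Fejer mean, from there to the degree-0 average, and
    from that to a scalar on the cylinder. *)
Lemma diag_comm_local x (e : R) : diag_comm s u x -> 0 < e ->
  exists k, forall c, exists l : R[i], nrm (x * cyl c k - l *: cyl c k) <= e.
Proof.
move=> xc e0; have e3 : 0 < e / 3 by lra.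
have [M M0 fej] := fejer_cvg rel gen gP x e3.
have d0 : 0 < e / 3 / M%:R by rewrite divr_gt0// ltr0n.
have small : ev (fun N w => forall a, (a < M)%N -> forall b, (b < M)%N ->
    a != b -> nrm (avg N w (a%:Z - b%:Z) x) <= e / 3 / M%:R).
  apply: ev_lt_forall => a _; apply: ev_lt_forall => b _.
  have [->|ab] := eqVneq a b; first by exists 0%N.
  have ab0 : a%:Z - b%:Z != 0 by rewrite subr_eq0 eqz_nat.
  by apply: (ev_sub (avg_vanish ab0 xc d0)).
have [N [w [prim [fx [sm [k /(_ k (leqnn k)) loc]]]]]] :=
  ev_ex (ev_and fej (ev_and small (avg_local x e3)
    (fun N w prim h1 h2 => conj h1 h2)) (fun N w prim h1 h2 => conj h1 h2)).
exists k => c; have [l hl] := loc c; exists l.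
have M0' : 0 < M%:R :> R by rewrite ltr0n.
have fa : nrm (fejer N w M x - avg N w 0 x) <= e / 3.
  have M0c : (M%:R : R[i]) != 0 by rewrite pnatr_eq0 -lt0n.
  (* The [M] terms with [a = b] make up the whole degree-0 average; only averages of nonzero degree
     remain. *)
  have -> : fejer N w M x - avg N w 0 x = M%:R^-1 *:
      \sum_(a < M) \sum_(b < M | b != a) avg N w (a%:Z - b%:Z) x.
    apply/eqP; rewrite /fejer subr_eq; apply/eqP.
    have -> : avg N w 0 x = M%:R^-1 *: \sum_(a < M) avg N w 0 x.
      by rewrite sumr_const card_ord -(scaler_nat M (avg N w 0 x)) scalerA mulVf// scale1r.
    rewrite -scalerDr -big_split/=; congr (_ *: _); apply: eq_bigr => a _.
    by rewrite (bigD1 a)//= subrr addrC.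
  rewrite nrmZ cabs_natV.
  rewrite ler_pdivrMl// (le_trans (nrm_sum _ _ _))//.
  apply: le_trans (_ : \sum_(a < M) (e / 3) <= _); last first.
    by rewrite sumr_const card_ord mulr_natl.
  apply: ler_sum => a _; apply: le_trans (nrm_sum _ _ _) _.
  apply: le_trans (_ : \sum_(b < M) (e / 3 / M%:R) <= _); last first.
    by rewrite sumr_const card_ord -[X in X <= _]mulr_natr divfK ?gt_eqF.
  rewrite [leLHS]big_mkcond/=; apply: ler_sum => b _; case: ifP => [ba|_].
    by apply: sm => //; rewrite val_eqE eq_sym.
  exact: ltW.
rewrite -(corner_comm _ _ xc).
have -> : corner c k x = corner c k (x - fejer N w M x) +
    corner c k (fejer N w M x - avg N w 0 x) + corner c k (avg N w 0 x).
  by rewrite -!cornerD addrA subrK subrK.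
rewrite -addrA (le_trans (nrmD _ _))// (le_trans (lerD (nrmD _ _) (lexx _)))//.
have := nrm_corner c k (x - fejer N w M x); rewrite nrmB.
have := nrm_corner c k (fejer N w M x - avg N w 0 x).
lra.
Qed.

End LocalScalar.

(** * Automorphisms fixing the diagonal *)

Section Generated.
Variables (R : realType) (A : cstarType R).

Lemma generated_min (X B : set A) : cstar_subalgebra B -> X `<=` B ->
  cstar_generated X `<=` B.
Proof. by move=> sB XB x; apply; split. Qed.

Lemma generated_sub (X : set A) x : X x -> cstar_generated X x.
Proof. by move=> Xx B [_]; exact. Qed.

Lemma equalizer_subalgebra (f h : A -> A) : unital_star_hom f -> unital_star_hom h ->
  cstar_subalgebra [set x | f x = h x].
Proof.
move=> fh hh; split=> /=.
- by rewrite (hom0 fh) (hom0 hh).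
- by move=> a x y fx fy; rewrite (homP fh) (homP hh) fx fy.
- by move=> x y fx fy; rewrite (homM fh) (homM hh) fx fy.
- by move=> x fx; rewrite (hom_star fh) (hom_star hh) fx.
- apply: closedP => x fx; apply: nrm_approx_eq => e e0.
  have [|y /= fy xy] := fx (e / 2); first by lra.
  have := nrm_tri (f y) (f x) (h x); rewrite {2}fy -(homB fh) -(homB hh).
  have := hom_nrm fh (x - y); have := hom_nrm hh (y - x); rewrite (nrmB y).
  lra.
Qed.

Lemma commutant_subalgebra p : star p = p -> cstar_subalgebra [set x : A | x * p = p * x].
Proof.
move=> sp; split=> /=.
- by rewrite mul0r mulr0.
- by move=> a x y xp yp; rewrite mulrDl mulrDr -scalerAl -scalerAr xp yp.
- by move=> x y xp yp; rewrite -mulrA yp mulrA xp mulrA.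
- by move=> x xp; rewrite -{1}sp -{2}sp -!starM xp.
- apply: closedP => x xc; apply: nrm_approx_eq => e e0.
  have B0 : 0 < 2 * (nrm p + 1) by rewrite mulr_gt0// ltr_wpDl ?nrm_ge0.
  have [y /= yc] := xc _ (divr_gt0 e0 B0); rewrite ltr_pdivlMr// => xy.
  have -> : x * p - p * x = (x - y) * p - p * (x - y).
    by rewrite mulrBl mulrBr yc opprB addrA subrK.
  have := nrmD ((x - y) * p) (- (p * (x - y))); rewrite nrmN.
  have := nrmM (x - y) p; have := nrmM p (x - y); have := nrm_ge0 (x - y).
  lra.
Qed.

Definition conj_by (d : A) (x : A) := d * x * star d.

Lemma conj_by_hom d : d * star d = 1 -> star d * d = 1 -> unital_star_hom (conj_by d).
Proof.
move=> d1 d2; rewrite /conj_by; split=> [a x y||x].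
- by rewrite mulrDr mulrDl -scalerAr -scalerAl.
- by split=> [|x y]; rewrite ?mulr1// !mulrA -(mulrA _ (star d) d) d2 mulr1.
- by rewrite !starM starK mulrA.
Qed.

Lemma conj_by_bij d : d * star d = 1 -> star d * d = 1 -> bijective (conj_by d).
Proof.
move=> d1 d2; exists (conj_by (star d)) => x; rewrite /conj_by starK !mulrA ?d1 ?d2.
  by rewrite mul1r -mulrA d2 mulr1.
by rewrite mul1r -mulrA d1 mulr1.
Qed.

Definition inner_aut d (d1 : d * star d = 1) (d2 : star d * d = 1) : star_aut A :=
  StarAut (conj_by_hom d1 d2) (conj_by_bij d1 d2).

(** The element is [z p + (1 - p)]: the phase [z] on the range of [p] and 1 on its complement. *)
Lemma phase_unitary (p : A) (z : R[i]) : star p = p -> p * p = p -> `|z| = 1 ->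
  (1 + (z - 1) *: p) * star (1 + (z - 1) *: p) = 1 /\
  star (1 + (z - 1) *: p) * (1 + (z - 1) *: p) = 1.
Proof.
move=> sp pp z1.
have zz : z * (z^*)%R = 1 by rewrite -normCK z1 expr1n.
rewrite starD star1 starZ sp rmorphB/= rmorph1.
rewrite !(mulrDl, mulrDr) !mul1r !mulr1 -!scalerAl -!scalerAr pp !scalerA.
rewrite -!addrA -!scalerDl; split; rewrite [X in X *: p](_ : _ = 0) ?scale0r ?addr0//.
  by rewrite mulrBl !mulrBr zz; ring.
by rewrite mulrBl !mulrBr mulrC zz; ring.
Qed.

End Generated.

(** * Consequences of local scalarity, and central elements *)

Section Diagonal.
Variables (R : realType) (A : cstarType R) (s u : A).
Hypothesis HQ : is_Q2 s u.
Implicit Types (x y : A) (c k : nat).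

Local Notation cyl := (cyl s u).
Local Notation D := (Q2_diagonal s u).

Let rel : Q2_relations s u. Proof. by case: HQ. Qed.
Let gen : cstar_generated [set 1; s; u] = setT. Proof. by case: HQ. Qed.

(** For [|z| = 1] the pair [z *: s], [u] again satisfies the relations, so universality provides
    [g z]. *)
Lemma gauge_exists : exists g : R[i] -> A -> A, forall z, `|z| = 1 ->
  [/\ unital_star_hom (g z), g z s = z *: s & g z u = u].
Proof.
have H (z : R[i]) : exists f : A -> A, `|z| = 1 ->
    [/\ unital_star_hom f, f s = z *: s & f u = u].
  (* Off the unit circle the identity serves as a default value. *)
  have [z1|z1] := eqVneq `|z| 1; last by exists id => /eqP; rewrite (negbTE z1).
  have [_ _ univ] := HQ.
  have zz : z * (z^*)%R = 1 by rewrite -normCK z1 expr1n.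
  have [|f ?] := univ A (z *: s) u; last by exists f.
  split.
  - by rewrite starZ -scalerAl -scalerAr scalerA mulrC zz scale1r (ss1 rel).
  - by split; [exact: uu1 rel|exact: uu1r rel].
  - rewrite starZ -!(scalerAl, scalerAr) !scalerA [(z^*)%R * z]mulrC zz !scale1r.
    exact: range_sum rel.
  - by rewrite -scalerAl -scalerAr (suE rel).
by have [g gP] := choice H; exists g.
Qed.

Lemma diag_comm_locally_scalar x (e : R) : diag_comm s u x -> 0 < e ->
  exists k, forall c, exists l : R[i], nrm (x * cyl c k - l *: cyl c k) <= e.
Proof.
by have [g gP] := gauge_exists; exact: (diag_comm_local rel gen gP).
Qed.

(** On a small cylinder [x] is close to a multiple of a projection fixed by [f], and [f] is
    contractive. *)
Lemma diag_comm_fixed f x : unital_star_hom f ->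
  (forall c k, f (cyl c k) = cyl c k) -> diag_comm s u x -> f x = x.
Proof.
move=> fh ffix xc; apply: nrm_approx_eq => e e0.
have [|k loc] := diag_comm_locally_scalar xc (_ : 0 < e / 2); first by lra.
have fxc : diag_comm s u (f x) by move=> c m; rewrite -(ffix c m) -!(homM fh) xc.
apply: (nrm_le_cyl rel (k := k)) => [|c]; first exact: diag_commB.
have [l hl] := loc c; rewrite mulrBl.
have := nrm_tri (l *: cyl c k) (f x * cyl c k) (x * cyl c k).
have -> : f x * cyl c k - l *: cyl c k = f (x * cyl c k - l *: cyl c k).
  by rewrite (homB fh) (homM fh) (homZ fh) ffix.
rewrite (nrmB (l *: _)).
by have := hom_nrm fh (x * cyl c k - l *: cyl c k); lra.
Qed.

(** On each small cylinder [x] is nearly scalar, so its commutator with [y] is small there. *)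
Lemma diag_comm_abelian x y : diag_comm s u x -> diag_comm s u y -> x * y = y * x.
Proof.
move=> xc yc; apply: nrm_approx_eq => e e0.
have B0 : 0 < 2 * (nrm y + 1) by rewrite mulr_gt0// ltr_wpDl ?nrm_ge0.
have [k loc] := diag_comm_locally_scalar xc (divr_gt0 e0 B0).
apply: (nrm_le_cyl rel (k := k)) => [|c]; first by apply: diag_commB; exact: diag_commM.
have [l] := loc c; rewrite ler_pdivlMr// => hl.
have -> : (x * y - y * x) * cyl c k =
    (x * cyl c k - l *: cyl c k) * y - y * (x * cyl c k - l *: cyl c k).
  rewrite !mulrBl mulrBr -scalerAl -scalerAr (yc c k) opprB.
  by rewrite addrA subrK -!mulrA (yc c k).
set v := _ - _ in hl *; have := nrmD (v * y) (- (y * v)); rewrite nrmN.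
have := nrmM v y; have := nrmM y v; have := nrm_ge0 v; lra.
Qed.

(** Binary digits with the first letter lowest; [One] is the digit 1 because [S_1 = U S_2]. *)
Definition word_index (alpha : seq letter) : nat :=
  foldr (fun i n => (if i is One then 1 else 0) + 2 * n)%N 0%N alpha.

Lemma word_diag alpha : Q2_word s u alpha = u ^+ word_index alpha * s ^+ size alpha.
Proof.
rewrite /Q2_word; elim: alpha => [|i alpha IH]; first by rewrite big_nil mulr1.
rewrite big_cons {}IH /=; have := sXuX rel 1 (word_index alpha).
rewrite !expr1 expn1 => su.
case: i; rewrite /= exprD ?expr1 ?expr0 ?mul1r exprS !mulrA ?su//.
by rewrite -(mulrA u) su !mulrA.
Qed.

Lemma proj_cyl alpha : Q2_proj s u alpha = cyl (word_index alpha) (size alpha).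
Proof. by rewrite /Q2_proj word_diag starM !starX cylE !mulrA. Qed.

Lemma cyl_proj c k : exists alpha, cyl c k = Q2_proj s u alpha.
Proof.
suff [alpha [sz ix]] : exists alpha, size alpha = k /\ (word_index alpha = c %[mod 2 ^ k])%N.
  by exists alpha; rewrite proj_cyl sz (cyl_mod rel ix).
elim: k c => [|k IH] c; first by exists [::]; rewrite !modn1.
have [alpha [sz ix]] := IH c./2.
exists ((if odd c then One else Two) :: alpha); split; rewrite /= ?sz//.
rewrite -[in RHS](odd_double_half c) -mul2n expnS.
have -> : (if (if odd c then One else Two) is One then 1 else 0)%N = odd c :> nat.
  by case: odd.
by apply/eqP; rewrite eqn_modDl -!muln_modr ix.
Qed.

Lemma cyl_diagonal c k : D (cyl c k).
Proof.
by apply: generated_sub; have [alpha ->] := cyl_proj c k; exists alpha.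
Qed.

Lemma diagonal_diag_comm x : D x -> diag_comm s u x.
Proof.
move=> Dx c k; move: x Dx; apply: generated_min.
  by apply: commutant_subalgebra; exact: star_cyl.
by move=> _ [alpha _ <-]; rewrite /= proj_cyl (cylC rel).
Qed.

Lemma fix_diagonal f : unital_star_hom f -> (forall c k, f (cyl c k) = cyl c k) ->
  forall x, D x -> f x = x.
Proof.
move=> fh ffix; apply: generated_min.
  exact: (equalizer_subalgebra fh (unital_star_hom_id A)).
by move=> _ [alpha _ <-]; rewrite /= proj_cyl ffix.
Qed.

Lemma hom_eq_gen (f h : A -> A) : unital_star_hom f -> unital_star_hom h ->
  f s = h s -> f u = h u -> f =1 h.
Proof.
move=> fh hh fs fu x; have : cstar_generated [set 1; s; u] x by rewrite gen.
apply: (generated_min (equalizer_subalgebra fh hh)).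
by move=> _ [[->|->]|->] //=; rewrite (hom1 fh) (hom1 hh).
Qed.

(** As [f] fixes the cylinders, [f u] translates them as [u] does, and [star u] undoes the
    translation. *)
Lemma twist_u f : unital_star_hom f -> (forall c k, f (cyl c k) = cyl c k) ->
  diag_comm s u (star u * f u).
Proof.
move=> fh ffix c k; rewrite -mulrA -{1}(ffix c k) -(homM fh).
have := uX_cyl rel 1 c k; rewrite !expr1 => ->.
rewrite (homM fh) ffix mulrA; have := uX'_cyl rel 1 c k; rewrite !expr1 => ->.
by rewrite mulrA.
Qed.

(** Cylinders of odd [c] are orthogonal to the range of [s], so both products vanish. For even [c],
    [star s] passes to [c / 2] and [f s] leads back. *)
Lemma twist_s f : unital_star_hom f -> (forall c k, f (cyl c k) = cyl c k) ->
  diag_comm s u (f s * star s).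
Proof.
move=> fh ffix c [|k]; first by rewrite (cyl0 rel) mulr1 mul1r.
case: (boolP (odd c)) => [odd_c|even_c].
  have cs0 : cyl c k.+1 * s = 0.
    have sE : s = cyl 0 1 * s.
      by rewrite cylE !expr0 !expr1 mul1r mulr1 -mulrA (ss1 rel) mulr1.
    rewrite [X in _ * X]sE mulrA (cylC rel) (cyl_disj rel) ?mul0r// mod0n expn1 modn2.
    by rewrite odd_c.
  rewrite -(star_cyl s u) -mulrA -starM cs0 star0 mulr0.
  by rewrite star_cyl -(ffix c k.+1) mulrA -(homM fh) cs0 (hom0 fh) mul0r.
have -> : c = (2 ^ 1 * c./2)%N.
  by rewrite expn1 mul2n -[LHS]odd_double_half (negbTE even_c).
rewrite -(addn1 k) -mulrA -{1}(expr1 (star s)) (sX'_cyl rel) expr1 mulrA.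
rewrite -{1}(ffix c./2 k) -(homM fh).
have := sX_cyl rel 1 c./2 k; rewrite !expr1 => ->.
by rewrite (homM fh) ffix mulrA.
Qed.

(** Powers of [u] carry [cyl c k] to every cylinder of level [k], and a central element passes
    through them. *)
Lemma central_cyl0 x c k : (forall y, x * y = y * x) -> x * cyl c k = 0 -> x = 0.
Proof.
move=> xc x0; apply/nrm_eq0/le_anti; rewrite nrm_ge0 andbT.
apply: (nrm_le_cyl rel (k := k)) => [c' k'|c']; first exact: xc.
have cc' : (c <= c' + 2 ^ k * c)%N.
  by rewrite (leq_trans _ (leq_addl _ _))// leq_pmull// expn_gt0.
rewrite -(cyl_period rel c' k c) -(subnKC cc').
set n := (_ - _)%N; rewrite -[cyl _ k]mulr1 -(uXKr rel n) (mulrA (cyl _ _)).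
by rewrite -(uX_cyl rel) !mulrA xc -(mulrA _ x) x0 mulr0 mul0r nrm0.
Qed.

(** At positive level the complement of a cylinder contains the neighbouring one, so [central_cyl0]
    applies there. *)
Lemma central_cylC0 x c k : (forall y, x * y = y * x) -> x * (1 - cyl c k.+1) = 0 -> x = 0.
Proof.
move=> xc x0; apply: (@central_cyl0 x (c + 1) k.+1) => //.
have orth : cyl c k.+1 * cyl (c + 1) k.+1 = 0.
  apply: (cyl_orth rel); rewrite -{1}[c]addn0 eqn_modDl mod0n modn_small//.
  by rewrite -{1}(expn0 2) ltn_exp2l.
have := congr1 (fun y => y * cyl (c + 1) k.+1) x0.
by rewrite -mulrA mulrBl mul1r orth subr0 mul0r.
Qed.

End Diagonal.

(** * Commutativity and maximality of the group fixing the diagonal *)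

Section AutFixing.
Variables (R : realType) (A : cstarType R) (s u : A).
Hypothesis HQ : is_Q2 s u.

Local Notation cyl := (cyl s u).
Local Notation D := (Q2_diagonal s u).

Let rel : Q2_relations s u. Proof. by case: HQ. Qed.

Lemma Aut_fixing_subgroup (X : set A) : subgroup (Aut_fixing X).
Proof.
split=> [x _ //|f h fX hX x Xx|f fX x Xx].
  by change (f (h x) = x); rewrite hX// fX.
have : (f^-1 * f)%g x = x by rewrite mulVg.
by change (f^-1%g (f x) = x -> f^-1%g x = x); rewrite fX.
Qed.

Lemma Aut_fixing_cyl f : Aut_fixing D f -> forall c k, f (cyl c k) = cyl c k.
Proof. by move=> fD c k; exact: fD (cyl_diagonal HQ c k). Qed.

Lemma Aut_fixing_abelian : abelian_set (Aut_fixing D).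
Proof.
move=> f h fD hD; apply: star_autP.
have [fh hh] := (star_aut_hom f, star_aut_hom h).
have [fc hc] := (Aut_fixing_cyl fD, Aut_fixing_cyl hD).
have fix_f x : diag_comm s u x -> f x = x by exact: diag_comm_fixed.
have fix_h x : diag_comm s u x -> h x = x by exact: diag_comm_fixed.
(* [k1] fixes the twist [star u * k2 u], so composition multiplies twists, and these commute;
   [comps] does the same for [s]. *)
have compu (k1 k2 : star_aut A) : (forall x, diag_comm s u x -> k1 x = x) ->
    Aut_fixing D k2 -> k1 (k2 u) = u * (star u * k1 u) * (star u * k2 u).
  move=> fix1 /Aut_fixing_cyl k2c; have k2h := star_aut_hom k2.
  rewrite (mulrA u) (uu1r rel) mul1r -(fix1 _ (twist_u HQ k2h k2c)).
  by rewrite -(homM (star_aut_hom k1)) (mulrA u) (uu1r rel) mul1r.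
have comps (k1 k2 : star_aut A) : (forall x, diag_comm s u x -> k1 x = x) ->
    Aut_fixing D k2 -> k1 (k2 s) = k2 s * star s * (k1 s * star s) * s.
  move=> fix1 /Aut_fixing_cyl k2c; have k2h := star_aut_hom k2.
  rewrite -(mulrA _ _ s) -(mulrA (k1 s)) (ss1 rel) mulr1 -(fix1 _ (twist_s HQ k2h k2c)).
  by rewrite -(homM (star_aut_hom k1)) -mulrA (ss1 rel) mulr1.
apply: (hom_eq_gen HQ (unital_star_hom_comp fh hh) (unital_star_hom_comp hh fh)) => /=.
  rewrite (comps f h)// (comps h f)//; congr (_ * _).
  by apply: (diag_comm_abelian HQ); exact: twist_s.
rewrite (compu f h)// (compu h f)// -!(mulrA u); congr (_ * _).
by apply: (diag_comm_abelian HQ); exact: twist_u.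
Qed.

(** Commuting with [Ad(d)] for [d = 1 + (z - 1) p] makes [star d * f d] central. Its values [X] at
    [z = -1] and [Y] at [z = 'i] are related through [p] and [1 - p], which yields [Y = 1] and so
    [f p = p]. *)
Lemma commuting_aut_diag (f : star_aut A) :
  (forall h, Aut_fixing D h -> (f * h = h * f)%g) -> Aut_fixing D f.
Proof.
move=> fcomm; have fh := star_aut_hom f.
(* Level 0 is the unit; positive level is what [central_cylC0] requires. *)
apply: (fix_diagonal HQ fh) => c [|k]; first by rewrite (cyl0 rel) (hom1 fh).
set p := cyl c k.+1; set e := f p.
have sp : star p = p := star_cyl s u c k.+1.
have pp : p * p = p := cyl_id rel c k.+1.
have key (z : R[i]) : `|z| = 1 -> exists2 X, (forall y, X * y = y * X) &
    1 + (z - 1) *: e = (1 + (z - 1) *: p) * X.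
  move=> z1; have [d1 d2] := phase_unitary sp pp z1.
  set d := 1 + _ in d1 d2 *.
  have fd : 1 + (z - 1) *: e = f d by rewrite (homD fh) (homZ fh) (hom1 fh).
  have adD : Aut_fixing D (inner_aut d1 d2).
    move=> x /(diagonal_diag_comm HQ)/(_ c k.+1) xp.
    change (d * x * star d = x).
    have -> : d * x = x * d by rewrite mulrDl mulrDr mul1r mulr1 -scalerAl -scalerAr xp.
    by rewrite -mulrA d1 mulr1.
  (* [f d] and [d] conjugate every [f y] alike; surjectivity of [f] then makes [star d * f d]
     central. *)
  have comm y : f d * f y * star (f d) = d * f y * star d.
    have := congr1 (fun h : star_aut A => h y) (fcomm _ adD).
    change (f (d * y * star d) = d * f y * star d ->
      f d * f y * star (f d) = d * f y * star d).
    by rewrite !(homM fh) (hom_star fh).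
  exists (star d * f d); last by rewrite fd mulrA d1 mul1r.
  have fd1 : star (f d) * f d = 1 by rewrite -(hom_star fh) -(homM fh) d2 (hom1 fh).
  have [f' fK f'K] := star_aut_bij f.
  move=> y; rewrite -(f'K y); set y' := f' y.
  have := congr1 (fun x => star d * x * f d) (comm y').
  by rewrite !mulrA d2 mul1r -!mulrA fd1 mulr1 !mulrA.
have [X Xc eX] := key (-1) (normrN1 _).
have [Y Yc eY] := key 'i (normCi _).
pose q := 1 - p.
have pz (z : R[i]) : p * (1 + (z - 1) *: p) = z *: p.
  by rewrite mulrDr mulr1 -scalerAr pp -{1}(scale1r p) -scalerDl addrC subrK.
have qz (z : R[i]) : q * (1 + (z - 1) *: p) = q.
  by rewrite mulrDr mulr1 -scalerAr mulrBl pp mul1r subrr scaler0 addr0.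
have two x : (2 : R[i]) *: x = x + x :> A by rewrite scaler_nat mulr2n.
have N2 : (-1 - 1 : R[i]) = -2 by rewrite -opprD.
(* Multiplying [eX] and [eY] by [p] and by [q] gives four equations in [p * e] and [q * e]. *)
have pX : 2 *: (p * e) = p + p * X.
  have := congr1 (fun x => p * x) eX.
  rewrite mulrA pz mulrDr mulr1 -scalerAr N2 scaleNr scaleN1r mulNr.
  by move=> h; rewrite -[p * X]opprK -h opprB addrC subrK.
have pY : ('i - 1) *: (p * e) = 'i *: (p * Y) - p.
  have := congr1 (fun x => p * x) eY.
  by rewrite mulrA pz mulrDr mulr1 -!(scalerAr, scalerAl) => <-; rewrite [RHS]addrC addKr.
have qX : 2 *: (q * e) = q - q * X.
  have := congr1 (fun x => q * x) eX.
  rewrite mulrA qz mulrDr mulr1 -scalerAr N2 scaleNr => <-.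
  by rewrite opprB addrC subrK.
have qY : ('i - 1) *: (q * e) = q * Y - q.
  have := congr1 (fun x => q * x) eY.
  by rewrite mulrA qz mulrDr mulr1 -scalerAr => <-; rewrite [RHS]addrC addKr.
have comm1 : (forall y, (1 : A) * y = y * 1) by move=> y; rewrite mul1r mulr1.
have cD (x y : A) : (forall v, x * v = v * x) -> (forall v, y * v = v * y) ->
    forall v, (x + y) * v = v * (x + y).
  by move=> xc yc v; rewrite mulrDl mulrDr xc yc.
have cZ (a : R[i]) (x : A) : (forall v, x * v = v * x) ->
    forall v, (a *: x) * v = v * (a *: x).
  by move=> xc v; rewrite -scalerAl xc scalerAr.
have cN (x : A) : (forall v, x * v = v * x) -> forall v, - x * v = v * - x.
  by move=> xc v; rewrite mulNr mulrN xc.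
(* Eliminating [p * e] makes this central element vanish on [p], hence everywhere; [C2] does the
   same with [q]. *)
have C1 : ('i - 1) *: (1 + X) - 2 *: ('i *: Y - 1) = 0.
  have C1c : forall v, (('i - 1) *: (1 + X) - 2 *: ('i *: Y - 1)) * v =
      v * (('i - 1) *: (1 + X) - 2 *: ('i *: Y - 1)).
    apply: (cD); first by apply: (cZ); exact: (cD).
    by apply: (cN); apply: (cZ); apply: (cD); [exact: (cZ)|exact: (cN)].
  apply: (central_cyl0 HQ (c := c) (k := k.+1)) => //; rewrite C1c -/p.
  rewrite mulrBr -!scalerAr mulrDr mulrBr mulr1 -scalerAr -pX -pY.
  by rewrite !scalerA mulrC subrr.
have C2 : ('i - 1) *: (1 - X) - 2 *: (Y - 1) = 0.
  have C2c : forall v, (('i - 1) *: (1 - X) - 2 *: (Y - 1)) * v =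
      v * (('i - 1) *: (1 - X) - 2 *: (Y - 1)).
    by apply: (cD); [|apply: (cN)]; apply: (cZ); apply: (cD) => //; exact: (cN).
  apply: (central_cylC0 HQ (c := c) (k := k)) => //; rewrite C2c -/p -/q.
  rewrite mulrBr -!scalerAr !mulrBr mulr1 -qX -qY.
  by rewrite !scalerA mulrC subrr.
have i1' : ('i : R[i]) + 1 != 0.
  rewrite addr_eq0; apply/eqP => i1; have := sqrCi R[i].
  by rewrite i1 sqrrN expr1n => /eqP; rewrite -subr_eq0 opprK -mulr2n pnatr_eq0.
have n2 : (2 : R[i]) != 0 by rewrite pnatr_eq0.
(* Adding [C1] and [C2] cancels [X] and leaves [('i + 1) Y = 'i + 1]. *)
have Y1 : Y = 1.
  apply: (scalerI i1'); apply: (scalerI n2).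
  move/(canRL (subrK _)): C1; rewrite add0r => C1.
  move/(canRL (subrK _)): C2; rewrite add0r => C2.
  have := congr2 +%R C1 C2; rewrite -!scalerDr addrACA subrr addr0 -two.
  rewrite !scalerA [_ * 2]mulrC -!scalerA => /(scalerI n2).
  rewrite addrACA -opprD -two.
  move=> h; congr (_ *: _); rewrite scalerDl scale1r -[LHS](subrK (2 *: 1)) -h.
  by rewrite -scalerDl; congr (_ *: _); ring.
have : 1 + ('i - 1) *: e = 1 + ('i - 1) *: p by rewrite eY Y1 mulr1.
have i1 : ('i : R[i]) - 1 != 0.
  rewrite subr_eq0; apply/eqP => i1; have := sqrCi R[i].
  by rewrite i1 expr1n => /eqP; rewrite -subr_eq0 opprK -mulr2n pnatr_eq0.
by move/addrI/(scalerI i1).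
Qed.

End AutFixing.

Theorem theorem3p6 (R : realType) (Q2 : cstarType R) (S2 U : Q2) :
  is_Q2 S2 U -> maximal_abelian (Aut_fixing (Q2_diagonal S2 U)).
Proof.
move=> HQ; split; [exact: Aut_fixing_subgroup|exact: Aut_fixing_abelian|].
move=> K _ abK [DK nKD]; apply: nKD => f Kf.
by apply: commuting_aut_diag => // h /DK; exact: abK.
Qed.
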